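(* Let $A$ be an Abelian variety defined over a number field $K$. Let $n\ge3$ and let $L/K$ be a Galois extension with Galois group isomorphic to the alternating group $A_n$. Then either $\operatorname{rk} A(L)=\operatorname{rk} A(K)$, or $\operatorname{rk} A(L)\geq \operatorname{rk} A(K)+2$ if $n=4$, and $\operatorname{rk} A(L)\geq \operatorname{rk} A(K)+n-1$ if $n=3$ or $n\ge 5$.
   Context: $\operatorname{rk} A(F)$ denotes the Mordell–Weil rank of $A$ over the field $F$. *)

(* Defs.v *)
(* Abelian varieties are taken in the classical language: a projective variety
   over K is a K-closed set of points over an algebraically closed field. *)
From mathcomp Require Import all_boot all_order all_algebra.
From mathcomp Require Import all_fingroup all_solvable all_field.
From mathcomp Require Import boolp.
From mathcomp.multinomials Require Import mpoly.

Set Implicit Arguments.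
Unset Strict Implicit.
Unset Printing Implicit Defensive.

Import GRing.Theory.
Local Open Scope ring_scope.

Definition proj_space (F : fieldType) (n : nat) :=
  {U : {vspace 'rV[F]_n.+1} | \dim U == 1%N}.

Definition hcoords (F : fieldType) (n : nat)
    (P : proj_space F n) (v : 'rV[F]_n.+1) : bool :=
  (v != 0) && (v \in val P).

Definition vanishes_at (F : fieldType) (n : nat)
    (f : {mpoly F[n.+1]}) (P : proj_space F n) : Prop :=
  forall v, hcoords P v -> f.@[v 0] = 0.

Section OverSubfield.

Variables (K Kbar : fieldType) (iota : {rmorphism K -> Kbar}).

Definition rational_point (n : nat) (P : proj_space Kbar n) : Prop :=
  exists v : 'rV[K]_n.+1, hcoords P (map_mx iota v).

Definition eval_forms (n m : nat) (f : 'I_m -> {mpoly K[n]})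
    (v : 'rV[Kbar]_n) : 'rV[Kbar]_m :=
  \row_i (map_mpoly iota (f i)).@[v 0].

Definition bihomogeneous (n1 n2 d e : nat) (f : {mpoly K[n1 + n2]}) : Prop :=
  forall m, m \in msupp f ->
    (\sum_(i < n1) m (lshift n2 i) = d)%N /\
    (\sum_(i < n2) m (rshift n1 i) = e)%N.

(* For a set X of points embedded in projective space by pt, a map X -> P^m is
   a morphism over K when around every point it is given by forms of the same
   degree with coefficients in K; similarly, with bihomogeneous forms, for a
   map X * X -> P^m. *)
Definition is_morphism (X : Type) (n m : nat) (pt : X -> proj_space Kbar n)
    (phi : X -> proj_space Kbar m) : Prop :=
  forall x : X, exists (d : nat) (f : 'I_m.+1 -> {mpoly K[n.+1]}),
    [/\ forall i, f i \is d.-homog,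
        forall u, hcoords (pt x) u -> eval_forms f u != 0
      & forall y u, hcoords (pt y) u -> eval_forms f u != 0 ->
          hcoords (phi y) (eval_forms f u)].

Definition is_morphism2 (X : Type) (n m : nat) (pt : X -> proj_space Kbar n)
    (phi : X -> X -> proj_space Kbar m) : Prop :=
  forall x1 x2 : X,
  exists (d e : nat) (f : 'I_m.+1 -> {mpoly K[n.+1 + n.+1]}),
    [/\ forall i, bihomogeneous d e (f i),
        forall u1 u2, hcoords (pt x1) u1 -> hcoords (pt x2) u2 ->
          eval_forms f (row_mx u1 u2) != 0
      & forall y1 y2 u1 u2, hcoords (pt y1) u1 -> hcoords (pt y2) u2 ->
          eval_forms f (row_mx u1 u2) != 0 ->
          hcoords (phi y1 y2) (eval_forms f (row_mx u1 u2))].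

End OverSubfield.

(* An abelian variety over K: a geometrically irreducible projective variety
   which is an algebraic group over K.  The group av_pts is A(algC), identified
   through av_embed with the common zero set of av_eqs in P^N(algC).  K is
   meant to be a number field, so that algC is an algebraic closure of
   iota(K), the reduced structure on the zero set is geometrically reduced and
   smoothness is automatic.  Commutativity, which holds by rigidity, is
   part of zmodType. *)
Record abelian_variety (K : fieldType) (iota : {rmorphism K -> algC}) := {
  av_ambient : nat;
  av_eqs : seq {mpoly K[av_ambient.+1]};
  av_eqs_homog : forall f, f \in av_eqs -> exists d : nat, f \is d.-homog;
  av_pts : zmodType;
  av_embed : av_pts -> proj_space algC av_ambient;
  av_embed_inj : injective av_embed;
  av_embed_image : forall P : proj_space algC av_ambient,
    (exists x, av_embed x = P) <->
    (forall f, f \in av_eqs -> vanishes_at (map_mpoly iota f) P);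
  av_irreducible : forall (d e : nat) (f g : {mpoly algC[av_ambient.+1]}),
    f \is d.-homog -> g \is e.-homog ->
    (forall x, vanishes_at (f * g) (av_embed x)) ->
    (forall x, vanishes_at f (av_embed x)) \/
    (forall x, vanishes_at g (av_embed x));
  av_zero_rational : rational_point iota (av_embed 0);
  av_opp_morphism : is_morphism iota av_embed (fun x => av_embed (- x));
  av_add_morphism : is_morphism2 iota av_embed (fun x y => av_embed (x + y))
}.

(* A(F), as a subset of A(algC), for a subfield j(F) of algC. *)
Definition av_rational (K : fieldType) (iota : {rmorphism K -> algC})
    (A : abelian_variety iota) (F : fieldType) (j : {rmorphism F -> algC})
    (x : av_pts A) : Prop :=
  rational_point j (av_embed x).

Definition has_indep_family (G : zmodType) (S : G -> Prop) (r : nat) : Prop :=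
  exists x : 'I_r -> G, (forall i, S (x i)) /\
    forall c : 'I_r -> int, \sum_i x i *~ c i = 0 -> forall i, c i = 0.

Definition is_rank (G : zmodType) (S : G -> Prop) (r : nat) : Prop :=
  has_indep_family S r /\ forall s, has_indep_family S s -> (s <= r)%N.

(* Natural numbers with a top element None = +oo. *)
Definition enat := option nat.

Definition enat_add (a : enat) (k : nat) : enat := omap (fun r => r + k)%N a.

Definition enat_le (a b : enat) : bool :=
  match a, b with
  | _, None => true
  | None, Some _ => false
  | Some r, Some s => (r <= s)%N
  end.

(* The maximal number of Z-independent elements of a subgroup S, +oo if there
   is none; by the Mordell-Weil theorem it is finite for S = A(F), F a number
   field. *)
Definition subgroup_rank (G : zmodType) (S : G -> Prop) : enat :=
  match pselect (exists r, is_rank S r) with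
  | left rP => Some (projT1 (cid rP))
  | right _ => None
  end.

Definition mw_rank (K : fieldType) (iota : {rmorphism K -> algC})
    (A : abelian_variety iota) (F : fieldType) (j : {rmorphism F -> algC}) :
    enat :=
  subgroup_rank (av_rational (A := A) j).

(* Main.v *)
(* The Galois group G = A_n acts on A(L), with invariants A(K), so A(L) (x) Q is
   a rational representation of dimension rk A(L) whose fixed vectors have
   dimension rk A(K). It remains to see that a nontrivial rational
   representation of A_n has dimension at least n - 1 if n >= 5, and at least 2
   always.

   An element of prime order p acting nontrivially has all p - 1 primitive
   eigenvalues, which settles n = 3, 4 (p = 3), n = 5 and n = 7. To induct, extend
   scalars to F = Q(omega), over which this still holds for p = 5, 7. Let x, y be
   disjoint 3-cycles. If (x - 1)(y - 1) <> 0 for some such pair, the omega- and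
   omega^2-eigenspaces of x are nontrivial representations of the A_(n-3) moving
   the points fixed by x, and n >= 8 gives dimension at least 2(n - 4) >= n - 1.
   Otherwise, for n >= 7, one finds vectors w_ij, permuted by A_n, which satisfy
   the linear relations of e_i - e_j, so that n - 1 of them are independent. The
   case n = 6 is treated separately. *)
Require Import Defs.
From mathcomp Require Import all_boot all_order all_algebra.
From mathcomp Require Import all_fingroup all_solvable all_field.
From mathcomp Require Import boolp.
From mathcomp.multinomials Require Import mpoly.
From mathcomp Require Import ring zify.

Set Implicit Arguments.
Unset Strict Implicit.
Unset Printing Implicit Defensive.

Import GRing.Theory.

(** * Even permutations supported on a set *)

(** The induction changes the set of moved points but not the ambient type: a representation is a
    map on all permutations of [T], required to be multiplicative only on the even ones supported on
    [S]. Matrices act on row vectors from the right, so [rho (g * h) = rho g *m rho h] matches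
    permutations and Galois automorphisms, whose products apply the left factor first. The cube root
    of unity splits a 3-cycle into eigenspaces, but it costs the bound for p = 3; hence the bound 2
    is proved over the rationals, before the extension. Over F the group A_4 has nontrivial
    one-dimensional characters, so the inductive step has to leave at least five points, that is n
    >= 8. For n = 6 neither method suffices: a 5-cycle gives only dimension 4, and the construction
    of the root vectors uses seven points. The space A(L) (x) Q never appears as such. A maximal
    independent family of A(L) serves as a basis, and each point has rational coordinates in it;
    points differing by torsion have the same ones. *)

Ltac split_neq U :=
  rewrite /= !inE !negb_or -?andbA ?andbT in U;
  repeat (let H := fresh "ne" in case/andP: U => H U).

Ltac decide_eqs :=
  repeat (rewrite ?eqxx /=;
    match goal with
    | H : is_true (?a != ?b) |- context [?a == ?b] => rewrite (negbTE H)
    | H : is_true (?a != ?b) |- context [?b == ?a] =>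
        rewrite (eq_sym b a) (negbTE H)
    end); rewrite ?eqxx /=.

Lemma tperm_if (T : finType) (x y z : T) :
  tperm x y z = if z == x then y else if z == y then x else z.
Proof. by case: tpermP => [->|->|/eqP/negbTE-> /eqP/negbTE->]; rewrite ?eqxx //; case: eqP. Qed.

(* Innermost transpositions are evaluated first: unfolding all of them at once
   would produce a term of exponential size. *)
Ltac perm_eval :=
  rewrite ?(permM, perm1);
  repeat (match goal with
  | |- context [fun_of_perm (tperm ?a ?b) ?z] =>
      is_var z; rewrite (tperm_if a b z); decide_eqs;
      repeat (match goal with
              | |- context [z == ?u] => destruct (eqVneq z u); [subst z|]
              end; decide_eqs)
  end).

Ltac perm_cases :=
  let x := fresh "x" in apply/permP => x; perm_eval => //.

Section AltOn.
Local Open Scope group_scope.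
Variable T : finType.
Implicit Types (S : {set T}) (g h : {perm T}).

Definition alt_on S g := perm_on S g && ~~ odd_perm g.

Lemma alt_on1 S : alt_on S 1.
Proof. by rewrite /alt_on perm_on1 odd_perm1. Qed.

Lemma alt_onM S g h : alt_on S g -> alt_on S h -> alt_on S (g * h).
Proof.
move=> /andP[gS g0] /andP[hS h0]; rewrite /alt_on perm_onM //.
by rewrite odd_permM (negbTE g0) (negbTE h0).
Qed.

Lemma alt_onV S g : alt_on S g -> alt_on S g^-1.
Proof. by case/andP=> gS g0; rewrite /alt_on perm_onV // odd_permV. Qed.

Lemma alt_onJ S g h : alt_on S g -> alt_on S h -> alt_on S (g ^ h).
Proof. by move=> gS hS; rewrite conjgE !(alt_onM, alt_onV). Qed.

Lemma alt_on_sub S S' g : S \subset S' -> alt_on S g -> alt_on S' g.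
Proof. by move=> sSS' /andP[gS g0]; rewrite /alt_on g0 andbT; apply: subset_trans gS sSS'. Qed.

Lemma perm_on_tperm S x y : x \in S -> y \in S -> perm_on S (tperm x y).
Proof.
move=> xS yS; apply: subset_trans (tperm_on x y) _.
by apply/subsetP=> z; rewrite !inE => /orP[] /eqP->.
Qed.

(** Since products apply the left factor first, this is a -> b -> c -> a. *)
Definition cyc3 (a b c : T) : {perm T} := tperm a b * tperm a c.
Definition dtr (a b c d : T) : {perm T} := tperm a b * tperm c d.

Lemma alt_on_cyc3 S a b c : uniq [:: a; b; c] -> {subset [:: a; b; c] <= S} ->
  alt_on S (cyc3 a b c).
Proof.
move=> U sS; split_neq U; rewrite /alt_on perm_onM ?perm_on_tperm ?sS ?inE ?eqxx ?orbT //=.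
by rewrite odd_permM !odd_tperm ne ne0.
Qed.

Lemma mem_alt_on_cyc3 S a b c : a != b -> a != c -> b != c ->
  a \in S -> b \in S -> c \in S -> alt_on S (cyc3 a b c).
Proof.
move=> ab ac bc aS bS cS; apply: alt_on_cyc3; first by rewrite /= !inE; decide_eqs.
by move=> x; rewrite !inE => /or3P[] /eqP->.
Qed.

Lemma alt_on_dtr S a b c d : a != b -> c != d ->
  {subset [:: a; b; c; d] <= S} -> alt_on S (dtr a b c d).
Proof.
move=> ab cd sS; rewrite /alt_on perm_onM ?perm_on_tperm ?sS ?inE ?eqxx ?orbT //=.
by rewrite odd_permM !odd_tperm ab cd.
Qed.

Lemma cyc3J a b c g : cyc3 a b c ^ g = cyc3 (g a) (g b) (g c).
Proof. by rewrite /cyc3 conjMg !tpermJ. Qed.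

Lemma dtrJ a b c d g : dtr a b c d ^ g = dtr (g a) (g b) (g c) (g d).
Proof. by rewrite /dtr conjMg !tpermJ. Qed.

Lemma cyc3V a b c : uniq [:: a; b; c] -> (cyc3 a b c)^-1 = cyc3 a c b.
Proof. by move=> U; split_neq U; rewrite /cyc3 invMg !tpermV. Qed.

(** Induction on the number of moved points: if [g] moves a to b, multiplying by (a c b) sends b
    back to a, so a becomes fixed; with c chosen among the points moved by [g], no new point is
    moved. *)
Lemma alt_on_ind S (P : {perm T} -> Prop) :
    P 1%g -> (forall g h, P g -> P h -> P (g * h)%g) ->
    (forall a b c, uniq [:: a; b; c] -> {subset [:: a; b; c] <= S} ->
      P (cyc3 a b c)) ->
  forall g, alt_on S g -> P g.
Proof.
move=> P1 PM P3 g; have [m] := ubnP #|[set x | g x != x]|.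
elim: m g => // m IHm g; rewrite ltnS => le_gm gS.
have [->//|g1] := eqVneq g 1%g.
have [a gaa] : exists a, g a != a.
  apply/existsP; apply: contraR g1; rewrite negb_exists => /forallP h.
  by apply/eqP/permP=> x; rewrite perm1; apply/eqP/negPn.
have [/subsetP gsub godd] := andP gS.
pose b := g a; have gbb : g b != b by rewrite /b (inj_eq perm_inj).
(* If [g] moved nothing besides a and b, it would be the transposition (a b), which is odd. *)
have [c /and3P[gcc ca cb]] : exists c, [&& g c != c, c != a & c != b].
  apply/existsP; apply: contraR godd; rewrite negb_exists => /forallP hc.
  have hfix x : x != a -> x != b -> g x = x.
    by move=> xa xb; apply/eqP; move: (hc x); rewrite xa xb !andbT negbK.
  have gba : g b = a.
    apply/eqP; apply: contraT => gba.
    by have := hfix _ gba gbb; move/perm_inj/eqP; rewrite (negbTE gbb).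
  suff ->: g = tperm a b by rewrite odd_tperm eq_sym.
  apply/permP=> x; rewrite tperm_if; case: eqVneq => [->//|xa].
  by case: eqVneq => [->//|xb]; apply: hfix.
have Uabc : uniq [:: a; b; c].
  by rewrite /= !inE !negb_or (eq_sym a b) (eq_sym a c) (eq_sym b c) gaa ca cb.
have sabc : {subset [:: a; b; c] <= S}.
  by move=> x; rewrite !inE => /or3P[] /eqP->; apply: gsub.
have Uacb : uniq [:: a; c; b].
  by rewrite /= !inE !negb_or (eq_sym a b) (eq_sym a c) gaa ca cb.
have sacb : {subset [:: a; c; b] <= S}.
  by move=> x; rewrite !inE => /or3P[] /eqP->; apply: sabc; rewrite !inE eqxx ?orbT.
have -> : g = ((g * cyc3 a c b) * cyc3 a b c)%g.
  by rewrite -(cyc3V Uabc) mulgKV.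
apply: (PM); last exact: P3.
apply: IHm; last by rewrite alt_onM // alt_on_cyc3.
apply: leq_trans le_gm; apply: proper_card; apply/properP; split.
  apply/subsetP=> x; rewrite !inE permM; apply: contra => /eqP gx; rewrite gx.
  have [xa xb xc] : [/\ x != a, x != b & x != c].
    by split; apply/eqP=> e; move: gx; rewrite e => /eqP; apply/negP.
  by rewrite /cyc3 permM !tpermD // eq_sym.
exists a; first by rewrite inE.
by rewrite inE negbK permM -/b /cyc3 permM (@tpermD _ a c b) ?tpermR // eq_sym.
Qed.

Lemma perm_on_trans S (s s' : seq T) : uniq s -> uniq s' -> size s = size s' ->
    {subset s <= S} -> {subset s' <= S} ->
  exists g : {perm T}, perm_on S g /\ map g s = s'.
Proof.
elim: s s' => [|x s IHs] [|x' s'] //=; first by exists 1%g; rewrite perm_on1.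
move=> /andP[xs Us] /andP[xs' Us'] [eq_sz] sS sS'.
have [||g [gS gs]] := IHs s' Us Us' eq_sz.
- by move=> y ys; apply: sS; rewrite inE ys orbT.
- by move=> y ys; apply: sS'; rewrite inE ys orbT.
have gxS : g x \in S by rewrite perm_closed // sS ?mem_head.
exists (g * tperm (g x) x')%g; split.
  by rewrite perm_onM // perm_on_tperm // sS' ?mem_head.
rewrite permM tpermL; congr (_ :: _); rewrite -gs; apply/eq_in_map=> y ys.
rewrite permM tpermD //; first by rewrite (inj_eq perm_inj); apply: contraNneq xs => ->.
by apply: contraNneq xs' => ->; rewrite -gs map_f.
Qed.

(** A permutation of the wrong parity is corrected by a transposition of two points of [S] outside
    [s']; the [+ 2] provides them. *)
Lemma alt_on_trans S (s s' : seq T) : uniq s -> uniq s' -> size s = size s' ->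
    {subset s <= S} -> {subset s' <= S} -> (size s + 2 <= #|S|)%N ->
  exists g : {perm T}, alt_on S g /\ map g s = s'.
Proof.
move=> Us Us' eq_sz sS sS' szS.
have [g [gS gs]] := perm_on_trans Us Us' eq_sz sS sS'.
have [godd|geven] := boolP (odd_perm g); last by exists g; rewrite /alt_on gS geven.
have : (1 < #|S :\: [set x in s']|)%N.
  rewrite cardsD; have : (#|S :&: [set x in s']| <= size s')%N.
    apply: leq_trans (subset_leq_card (subsetIr _ _)) _.
    by rewrite cardsE; apply: card_size.
  by move: szS; rewrite eq_sz; lia.
case/card_gt1P=> p [q [+ + pq]]; rewrite !inE => /andP[ps' pS] /andP[qs' qS].
exists (g * tperm p q)%g; split.
  by rewrite /alt_on perm_onM ?perm_on_tperm // odd_permM godd odd_tperm pq.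
rewrite -[RHS]gs; apply/eq_in_map=> y ys; have gys : g y \in s' by rewrite -gs map_f.
rewrite permM tpermD //; first by apply: contraNneq ps' => ->.
by apply: contraNneq qs' => ->.
Qed.

End AltOn.

Local Open Scope ring_scope.

(** * Representations of alternating groups *)

Definition alt_rep (T : finType) (F : fieldType) (d : nat) (S : {set T})
    (rho : {perm T} -> 'M[F]_d) : Prop :=
  rho 1%g = 1%:M /\
  forall g h, alt_on S g -> alt_on S h -> rho (g * h)%g = rho g *m rho h.

Definition rep_nontriv (T : finType) (F : fieldType) (d : nat) (S : {set T})
    (rho : {perm T} -> 'M[F]_d) : Prop :=
  exists2 g, alt_on S g & rho g != 1%:M.

Section AltRep.
Variables (T : finType) (F : fieldType) (d : nat) (S : {set T}).
Variable rho : {perm T} -> 'M[F]_d.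
Hypothesis rhoP : alt_rep S rho.

Lemma alt_rep1 : rho 1%g = 1%:M. Proof. by case: rhoP. Qed.

Lemma alt_repM g h : alt_on S g -> alt_on S h -> rho (g * h)%g = rho g *m rho h.
Proof. by case: rhoP => _; apply. Qed.

Lemma alt_repVr g : alt_on S g -> rho g *m rho g^-1%g = 1%:M.
Proof. by move=> gS; rewrite -alt_repM ?alt_onV // mulgV alt_rep1. Qed.

Lemma alt_repVl g : alt_on S g -> rho g^-1%g *m rho g = 1%:M.
Proof. by move=> gS; rewrite -alt_repM ?alt_onV // mulVg alt_rep1. Qed.

Lemma alt_repJ g h : alt_on S g -> alt_on S h ->
  rho h *m rho (g ^ h)%g = rho g *m rho h.
Proof. by move=> gS hS; rewrite -!alt_repM ?alt_onJ // -conjgC. Qed.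

Lemma alt_repX g k : alt_on S g -> rho (g ^+ k)%g = rho g ^+ k.
Proof.
move=> gS; elim: k => [|k IH]; first by rewrite expg0 expr0 alt_rep1.
have gkS : alt_on S (g ^+ k)%g.
  by elim: k {IH} => [|k IH]; rewrite ?expg0 ?alt_on1 // expgS alt_onM.
by rewrite expgS exprS alt_repM // IH.
Qed.

Lemma alt_rep_inj g k (u v : 'M_(k, d)) : alt_on S g ->
  u *m rho g = v *m rho g -> u = v.
Proof.
by move=> gS /(congr1 (mulmx^~ (rho g^-1%g))); rewrite -!mulmxA alt_repVr // !mulmx1.
Qed.

Lemma alt_rep_comm g h : alt_on S g -> alt_on S h -> commute g h ->
  rho g *m rho h = rho h *m rho g.
Proof. by move=> gS hS com; rewrite -!alt_repM // com. Qed.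

Lemma alt_repJ_eq1 g h : alt_on S g -> alt_on S h ->
  rho g = 1%:M -> rho (g ^ h)%g = 1%:M.
Proof.
move=> gS hS g1; rewrite -[LHS]mul1mx -(alt_repVl hS) -mulmxA alt_repJ //.
by rewrite g1 mul1mx.
Qed.

Lemma fix_cyc3_fix (S' : {set T}) k (W : 'M_(k, d)) : S' \subset S ->
    (forall a b c, uniq [:: a; b; c] -> {subset [:: a; b; c] <= S'} ->
      W *m rho (cyc3 a b c) = W) ->
  forall g, alt_on S' g -> W *m rho g = W.
Proof.
move=> sS' Wfix g gS'.
suff [] : alt_on S' g /\ W *m rho g = W by [].
elim/(alt_on_ind (S := S')): g / gS'; first by rewrite alt_on1 alt_rep1 mulmx1.
  move=> g h [gS' Wg] [hS' Wh]; rewrite alt_onM //.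
  by rewrite alt_repM ?(alt_on_sub sS') // mulmxA Wg Wh.
by move=> a b c U sabc; rewrite alt_on_cyc3 // Wfix.
Qed.

(** With five points all 3-cycles are conjugate under even permutations; as they generate, one
    acting trivially would make the representation trivial. *)
Lemma cyc3_nontriv : (5 <= #|S|)%N -> rep_nontriv S rho ->
  forall a b c, uniq [:: a; b; c] -> {subset [:: a; b; c] <= S} ->
  rho (cyc3 a b c) != 1%:M.
Proof.
move=> cS [g gS /eqP g1] a b c U sabc; apply/eqP=> abc1; apply: g1.
rewrite -[rho g]mul1mx; apply: fix_cyc3_fix gS => // a' b' c' U' sabc'.
rewrite mul1mx.
have [|h [hS [<- <- <-]]] := alt_on_trans U U' (erefl _) sabc sabc'; first by rewrite /= addn2.
by rewrite -cyc3J alt_repJ_eq1 // alt_on_cyc3.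
Qed.

(* A double transposition times a conjugate of it is a 3-cycle. *)
Lemma dtr_nontriv : (5 <= #|S|)%N -> rep_nontriv S rho ->
  forall a b c d, uniq [:: a; b; c; d] -> {subset [:: a; b; c; d] <= S} ->
  rho (dtr a b c d) != 1%:M.
Proof.
move=> cS nt a b c e U sS; apply/eqP=> s1.
have [f fS fn] : exists2 f, f \in S & f \notin [:: a; b; c; e].
  apply/subsetPn; apply: contraL cS => /subset_leq_card h; rewrite -ltnNge ltnS.
  by apply: leq_trans h _; apply: card_size.
have U5 : uniq [:: a; b; c; e; f].
  have : uniq (rcons [:: a; b; c; e] f) by rewrite rcons_uniq fn.
  by [].
split_neq U5.
have [aS bS cS' eS] : [/\ a \in S, b \in S, c \in S & e \in S].
  by split; apply: sS; rewrite !inE eqxx ?orbT.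
have sS1 : alt_on S (dtr a b c e) by apply: alt_on_dtr.
have gS : alt_on S (dtr e f a b).
  by apply: alt_on_dtr => // x; rewrite !inE => /or4P[] /eqP->.
have s2 : rho (dtr a b c f) = 1%:M.
  have := alt_repJ_eq1 sS1 gS s1; rewrite dtrJ.
  suff -> : dtr (dtr e f a b a) (dtr e f a b b) (dtr e f a b c) (dtr e f a b e) = dtr a b c f by [].
  by rewrite /dtr; perm_eval; rewrite tpermC.
have U3 : uniq [:: c; f; e] by rewrite /= !inE; decide_eqs.
have s3 : {subset [:: c; f; e] <= S} by move=> x; rewrite !inE => /or3P[] /eqP->.
have /eqP := cyc3_nontriv cS nt U3 s3; apply.
have -> : cyc3 c f e = (dtr a b c f * dtr a b c e)%g.
  by rewrite /cyc3 /dtr; perm_cases.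
by rewrite alt_repM ?s1 ?s2 ?mulmx1 // alt_on_dtr // => x; rewrite !inE => /or4P[] /eqP->.
Qed.

(** Restriction to the row space of [W], in the basis [row_base W], with [pinvmx] reading off
    coordinates. The second clause serves to prove that [rho'] is nontrivial. *)
Lemma subrep_exists k (W : 'M_(k, d)) :
    (forall g, alt_on S g -> (W *m rho g <= W)%MS) ->
  exists rho' : {perm T} -> 'M[F]_(\rank W), alt_rep S rho' /\
    forall g, alt_on S g -> rho' g = 1%:M -> W *m rho g = W.
Proof.
move=> Wst; pose B := row_base W.
have Bst g : alt_on S g -> (B *m rho g <= B)%MS.
  by move=> gS; rewrite eq_row_base (eqmxMr _ (eq_row_base W)) Wst.
exists (fun g => B *m rho g *m pinvmx B); split; last first.
  move=> g gS eq1; have BgB : B *m rho g = B.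
    by rewrite -[LHS](mulmxKpV (Bst g gS)) eq1 mul1mx.
  have /submxP[C ->] : (W <= B)%MS by rewrite eq_row_base.
  by rewrite -mulmxA BgB.
split; first by rewrite alt_rep1 mulmx1 mulmxVp // row_base_free.
move=> g h gS hS; rewrite alt_repM //.
by rewrite !mulmxA -{1}(mulmxKpV (Bst g gS)) !mulmxA.
Qed.

End AltRep.

(* Every element of order p generates at least the p - 1 conjugate
   eigenvalues. *)
Definition cyclotomic_bound (F : fieldType) (p : nat) : Prop :=
  forall d (M : 'M[F]_d), M ^+ p = 1 -> M != 1 -> (p.-1 <= d)%N.

(** * Degrees five and seven, by cycles of prime length *)

Section SmallCases.
Variables (T : finType) (F : fieldType) (d : nat) (S : {set T}).
Variable rho : {perm T} -> 'M[F]_d.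
Hypothesis rhoP : alt_rep S rho.
Hypothesis cS : (5 <= #|S|)%N.
Hypothesis nt : rep_nontriv S rho.

(* If the long cycle c acts trivially, so does the 3-cycle obtained as the
   quotient of (a b c') and its conjugate (b c' e). *)
Lemma long_cycle_bound p (g : {perm T}) a b c e : cyclotomic_bound F p ->
  uniq [:: a; b; c; e] -> {subset [:: a; b; c; e] <= S} ->
  alt_on S g -> (g ^+ p = 1)%g -> g a = b -> g b = c -> g c = e ->
  (p.-1 <= d)%N.
Proof.
move=> bound U sS gS gp ga gb gc; apply: (bound d (rho g)).
  by rewrite -(alt_repX rhoP) // gp (alt_rep1 rhoP).
have [aS bS cS' eS] : [/\ a \in S, b \in S, c \in S & e \in S].
  by split; apply: sS; rewrite !inE eqxx ?orbT.
apply/eqP=> g1; split_neq U.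
have U1 : uniq [:: a; b; c] by rewrite /= !inE; decide_eqs.
have U2 : uniq [:: b; c; e] by rewrite /= !inE; decide_eqs.
have U3 : uniq [:: b; e; c] by rewrite /= !inE; decide_eqs.
have U4 : uniq [:: a; b; e] by rewrite /= !inE; decide_eqs.
have s1 : {subset [:: a; b; c] <= S} by move=> x; rewrite !inE => /or3P[] /eqP->.
have s2 : {subset [:: b; c; e] <= S} by move=> x; rewrite !inE => /or3P[] /eqP->.
have s3 : {subset [:: b; e; c] <= S} by move=> x; rewrite !inE => /or3P[] /eqP->.
have s4 : {subset [:: a; b; e] <= S} by move=> x; rewrite !inE => /or3P[] /eqP->.
have E : rho (cyc3 b c e) = rho (cyc3 a b c).
  have := alt_repJ rhoP (alt_on_cyc3 U1 s1) gS.
  by rewrite cyc3J ga gb gc g1 mul1mx mulmx1.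
have /eqP := cyc3_nontriv rhoP cS nt U4 s4; apply.
have -> : cyc3 a b e = (cyc3 b e c * cyc3 a b c)%g by rewrite /cyc3; perm_cases.
rewrite (alt_repM rhoP) ?alt_on_cyc3 // -E -(cyc3V U2).
by rewrite (alt_repVl rhoP) // alt_on_cyc3.
Qed.

Lemma enum_set_uniq (s : seq T) : s = enum S -> uniq s /\ {subset s <= S}.
Proof. by move=> ->; rewrite enum_uniq; split=> // x; rewrite mem_enum. Qed.

Lemma alt5_rep_bound : #|S| = 5 -> cyclotomic_bound F 5 -> (4 <= d)%N.
Proof.
rewrite cardE; case E: (enum S) => [|a [|b [|c [|e [|f []]]]]] // _ bound.
have [U sS] := enum_set_uniq (esym E).
have [aS bS cS' eS fS] : [/\ a \in S, b \in S, c \in S, e \in S & f \in S].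
  by split; apply: sS; rewrite !inE eqxx ?orbT.
split_neq U.
(* The product is the 5-cycle (a b c e f). *)
apply: (@long_cycle_bound 5 (cyc3 a b c * cyc3 a e f)%g a b c e) => //.
- by rewrite /= !inE; decide_eqs.
- by move=> x xs; apply: sS; move: xs; rewrite !inE => /or4P[] /eqP->; rewrite eqxx ?orbT.
- by apply: alt_onM; apply: mem_alt_on_cyc3.
- by rewrite /cyc3 !expgS expg0; perm_cases.
all: by rewrite /cyc3; perm_eval.
Qed.

Lemma alt7_rep_bound : #|S| = 7 -> cyclotomic_bound F 7 -> (6 <= d)%N.
Proof.
rewrite cardE; case E: (enum S) => [|a [|b [|c [|e [|f [|g [|h []]]]]]]] // _ bound.
have [U sS] := enum_set_uniq (esym E).
have [aS bS cS' eS] : [/\ a \in S, b \in S, c \in S & e \in S].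
  by split; apply: sS; rewrite !inE eqxx ?orbT.
have [fS gS hS] : [/\ f \in S, g \in S & h \in S].
  by split; apply: sS; rewrite !inE eqxx ?orbT.
split_neq U.
(* The product is the 7-cycle (a b c e f g h). *)
apply: (@long_cycle_bound 7 (cyc3 a b c * (cyc3 a e f * cyc3 a g h))%g a b c e) => //.
- by rewrite /= !inE; decide_eqs.
- by move=> x xs; apply: sS; move: xs; rewrite !inE => /or4P[] /eqP->; rewrite eqxx ?orbT.
- by apply: alt_onM; [|apply: alt_onM]; apply: mem_alt_on_cyc3.
- by rewrite /cyc3 !expgS expg0; perm_cases.
all: by rewrite /cyc3; perm_eval.
Qed.

End SmallCases.

Lemma alt_rep_sub (T : finType) (F : fieldType) d (S S' : {set T})
    (rho : {perm T} -> 'M[F]_d) :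
  S' \subset S -> alt_rep S rho -> alt_rep S' rho.
Proof.
move=> sS [rho1 rhoM]; split=> // g h gS hS.
by rewrite rhoM // (alt_on_sub sS).
Qed.

(** * Elements of order three *)

Ltac mx_linear := apply/matrixP => ? ?; rewrite !mxE; ring.

Section Klein.
Variables (F : fieldType) (d : nat) (r s t : 'M[F]_d).
Hypothesis F4 : 4%:R != 0 :> F.
Hypotheses (ss : s * s = 1) (tt : t * t = 1) (st : s * t = t * s).
Hypotheses (sr : s * r = r * t) (tr : t * r = r * s * t).
Hypothesis r0 : 1 + r + r * r = 0.

(* Here (r, s, t) generate a copy of A_4. Since 1 + z + z^2 = 0 for the four
   conjugates z = r, rs, rt, rst of r, summing over them and comparing with
   (1 + r + r^2) N = 0, where N = 1 + s + t + st, gives N = 4. *)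
Lemma klein_trivial : s = 1.
Proof.
pose N := 1 + s + t + s * t.
have conj_r0 z : z * z = 1 -> 1 + z * r * z + (z * r * z) * (z * r * z) = 0.
  move=> zz; transitivity (z * (1 + r + r * r) * z); last by rewrite r0 mulr0 mul0r.
  by rewrite !mulrDr !mulrDl mulr1 zz !mulrA -(mulrA _ z z) zz mulr1.
have e1 : s * r * s = r * (s * t) by rewrite sr -mulrA -st.
have e2 : t * r * t = r * s by rewrite tr -mulrA tt mulr1.
have stst : s * t * (s * t) = 1.
  by rewrite {2}st mulrA -(mulrA s t t) tt mulr1.
have e3 : (s * t) * r * (s * t) = r * t.
  by rewrite -(mulrA s t r) tr !mulrA sr -!mulrA (mulrA s t) stst mulr1.
(* The squares of the conjugates rst, rs, rt are r^2 t, r^2 st, r^2 s: both the conjugates and their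
   squares exhaust the terms of r N and r^2 N. *)
have q1 : r * (s * t) * (r * (s * t)) = r * r * t.
  rewrite -e1 !mulrA -(mulrA (s * r) s s) ss mulr1 sr -(mulrA r t r) tr !mulrA.
  by rewrite -(mulrA (r * r * s)) -st mulrA -(mulrA (r * r)) ss mulr1.
have q2 : r * s * (r * s) = r * r * (s * t).
  by rewrite mulrA -(mulrA r s r) sr mulrA -!mulrA st.
have q3 : r * t * (r * t) = r * r * s.
  by rewrite mulrA -(mulrA r t r) tr !mulrA -(mulrA _ t t) tt mulr1.
have z1 := conj_r0 s ss; rewrite e1 q1 in z1.
have z2 := conj_r0 t tt; rewrite e2 q2 in z2.
have z3 := conj_r0 (s * t) stst; rewrite e3 q3 in z3.
have N4 : N = 1 *+ 4.
  have eN : N + r * N + r * r * N = 0.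
    by rewrite -{1}[N]mul1r -!mulrDl r0 mul0r.
  have e4 : 1 *+ 4 + r * N + r * r * N = 0.
    transitivity ((1 + r + r * r) + (1 + r * (s * t) + r * r * t)
      + (1 + r * s + r * r * (s * t)) + (1 + r * t + r * r * s)); last first.
      by rewrite r0 z1 z2 z3 !addr0.
    rewrite /N !mulrDr !mulr1; clear.
    generalize (r * r * (s * t)) (r * r * s) (r * r * t) (r * (s * t)) (r * s) (r * t) (r * r) (1 : 'M[F]_d).
    by move=> *; mx_linear.
  by apply: (addIr (r * N + r * r * N)); rewrite !addrA eN e4.
have sN : s * N = N.
  rewrite /N !mulrDr mulr1 ss mulrA ss mul1r.
  by rewrite [s + 1]addrC -addrA [s * t + t]addrC addrA.
(* Multiplication by s permutes the terms of N = 4, so 4s = 4. *)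
have /eqP : 4%:R *: (s - 1) = 0.
  by rewrite scaler_nat mulrnBl; move: sN; rewrite N4 mulrnAr mulr1 => ->; rewrite subrr.
by rewrite scaler_eq0 (negbTE F4) subr_eq0 => /eqP.
Qed.
End Klein.

Section CubeRoot.
Variable F : fieldType.
Hypothesis F_char0 : forall n, n.+1%:R != 0 :> F.

Definition prim3 (a : F) : Prop := a ^+ 2 + a + 1 = 0.

Lemma prim3_sq a : prim3 a -> a ^+ 2 = - (1 + a).
Proof. by move=> /eqP; rewrite -addrA addr_eq0 => /eqP->; rewrite addrC. Qed.

Lemma prim3_cube a : prim3 a -> a ^+ 3 = 1.
Proof.
move=> p; apply/eqP; rewrite -subr_eq0; apply/eqP.
transitivity ((a - 1) * (a ^+ 2 + a + 1)); first by ring.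
by rewrite p mulr0.
Qed.

Lemma prim3_4 a : prim3 a -> (a ^+ 2) ^+ 2 = a.
Proof. by move=> p; rewrite -exprM -[(2 * 2)%N]/(3 + 1)%N exprD prim3_cube // mul1r expr1. Qed.

Lemma prim3_conj a : prim3 a -> prim3 (a ^+ 2).
Proof. by move=> p; rewrite /prim3 prim3_4 // [a + _]addrC. Qed.

Lemma prim3_neq1 a : prim3 a -> a != 1.
Proof.
move=> p; apply: contraNneq (F_char0 2) => a1; apply/eqP.
by rewrite -[RHS]p a1; ring.
Qed.

Lemma prim3_neq a : prim3 a -> a != a ^+ 2.
Proof.
move=> p; apply: contraNneq (prim3_neq1 p) => e.
have a0 : a != 0 by apply/eqP=> a0; move: p; rewrite /prim3 a0 expr0n !add0r => /eqP; rewrite oner_eq0.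
by apply/eqP/(mulfI a0); rewrite mulr1 -expr2.
Qed.

Lemma regM k d (M : 'M[F]_(k, d)) n : M *+ n.+1 = 0 -> M = 0.
Proof.
by rewrite -scaler_nat => /eqP; rewrite scaler_eq0 (negbTE (F_char0 n)) => /eqP.
Qed.

Section Order3.
Variables (d : nat) (X : 'M[F]_d).
Hypothesis X3 : X *m X *m X = 1%:M.

Lemma cube_kill k (v : 'M_(k, d)) : (v <= (X - 1%:M)%R)%MS ->
  v + v *m X + v *m X *m X = 0.
Proof.
case/submxP=> u e; transitivity (v *m (1%:M + X + X *m X)).
  by rewrite !mulmxDr mulmx1 mulmxA.
rewrite e -mulmxA; suff -> : (X - 1%:M) *m (1%:M + X + X *m X) = 0 by rewrite mulmx0.
rewrite mulmxBl mul1mx !mulmxDr mulmx1 mulmxA X3.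
by move: (X *m X) => Y; mx_linear.
Qed.

(** For X^3 = 1 and a primitive cube root of unity a, this is three times the projector onto the
    a-eigenspace of X, the coefficients being the powers of a^-1. *)
Definition proj3 (a : F) : 'M[F]_d := 1%:M + a ^+ 2 *: X + a *: (X *m X).

Lemma proj3_eig a : prim3 a -> proj3 a *m X = a *: proj3 a.
Proof.
move=> p; rewrite /proj3 !mulmxDl mul1mx -!scalemxAl X3 !scalerDr !scalerA -exprS prim3_cube //.
by rewrite scale1r; move: (X *m X) => Y; mx_linear.
Qed.

(** The three projectors add up to 1, and X - 1 kills the one for the eigenvalue 1. *)
Lemma proj3_sum a : prim3 a -> (X - 1%:M) *m (proj3 a + proj3 (a ^+ 2)) = (X - 1%:M) *+ 3.
Proof.
move=> p; have e : a ^+ 2 = - (1 + a) := prim3_sq p.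
have -> : proj3 a + proj3 (a ^+ 2) = 1%:M *+ 2 - X - X *m X.
  by rewrite /proj3 prim3_4 // e; move: (X *m X) => Y; mx_linear.
rewrite mulr2n !mulmxBr mulmxDr !mulmxBl !mul1mx !mulmx1 mulmxA X3; move: (X *m X) => Y.
by mx_linear.
Qed.

(** By [proj3_sum], the image of X - 1 lies in the sum of the two nontrivial eigenspaces, once 3 is
    cancelled. *)
Lemma eig3_fix a (M : 'M_d) : prim3 a ->
    eigenspace X a *m M = eigenspace X a ->
    eigenspace X (a ^+ 2) *m M = eigenspace X (a ^+ 2) ->
  (X - 1%:M) *m M = X - 1%:M.
Proof.
move=> p Ma Ma2; apply/eqP; rewrite -subr_eq0; apply/eqP; apply: (@regM _ _ _ 2).
have key b : prim3 b -> eigenspace X b *m M = eigenspace X b ->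
  (X - 1%:M) *m proj3 b *m M = (X - 1%:M) *m proj3 b.
  move=> pb Mb; have /submxP[C ->] : ((X - 1%:M) *m proj3 b <= eigenspace X b)%MS.
    by apply/eigenspaceP; rewrite -mulmxA proj3_eig // scalemxAr.
  by rewrite -mulmxA Mb.
rewrite mulrnBl -!scaler_nat scalemxAl !scaler_nat -(proj3_sum p) mulmxDr mulmxDl !key ?subrr //.
exact: prim3_conj.
Qed.

Lemma rank_eig2 a b k1 k2 k3 (A : 'M_(k1, d)) (B : 'M_(k2, d)) (C : 'M_(k3, d)) :
  a != b -> (A <= eigenspace X a)%MS -> (B <= eigenspace X b)%MS ->
  (A <= C)%MS -> (B <= C)%MS -> (\rank A + \rank B <= \rank C)%N.
Proof.
move=> ab Aa Bb AC BC.
have AB0 : (A :&: B = 0)%MS.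
  apply/eqP; rewrite -submx0; apply/rV_subP=> v; rewrite sub_capmx => /andP[vA vB].
  have /eigenspaceP va := submx_trans vA Aa.
  have /eigenspaceP vb := submx_trans vB Bb.
  move/eqP: va; rewrite vb -subr_eq0 -scalerBl scaler_eq0 subr_eq0 eq_sym (negbTE ab) /=.
  by move/eqP->; apply: sub0mx.
by rewrite -(mxrank_disjoint_sum AB0) mxrankS // addsmx_sub AC BC.
Qed.

End Order3.

End CubeRoot.

Lemma cyc3_cube (T : finType) (a b c : T) : uniq [:: a; b; c] ->
  (cyc3 a b c * cyc3 a b c * cyc3 a b c = 1)%g.
Proof. by rewrite /cyc3 => U; split_neq U; perm_cases. Qed.

Lemma eigenspace_mul (F : fieldType) d (X : 'M[F]_d) a :
  eigenspace X a *m X = a *: eigenspace X a.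
Proof. exact/eigenspaceP. Qed.

(** * Eigenspaces of a 3-cycle and the inductive step *)

Section Eigenspaces.
Variables (T : finType) (F : fieldType) (d : nat) (S : {set T}).
Variable rho : {perm T} -> 'M[F]_d.
Hypothesis F_char0 : forall n, n.+1%:R != 0 :> F.
Hypothesis rhoP : alt_rep S rho.

Lemma rho_cyc3_cube a b c : uniq [:: a; b; c] -> {subset [:: a; b; c] <= S} ->
  rho (cyc3 a b c) *m rho (cyc3 a b c) *m rho (cyc3 a b c) = 1%:M.
Proof.
move=> U sS; have xS := alt_on_cyc3 U sS.
rewrite -!(alt_repM rhoP) //; last by apply: alt_onM.
by rewrite cyc3_cube // (alt_rep1 rhoP).
Qed.

Lemma eig_comm x g b : alt_on S x -> alt_on S g -> commute x g ->
  (eigenspace (rho x) b *m rho g <= eigenspace (rho x) b)%MS.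
Proof.
move=> xS gS com; apply/eigenspaceP.
rewrite -mulmxA -(alt_rep_comm rhoP xS gS com) mulmxA.
by rewrite eigenspace_mul scalemxAl.
Qed.

Lemma eigV k (W : 'M_(k, d)) x b : alt_on S x -> prim3 b ->
  W *m rho x = b *: W -> W *m rho (x^-1)%g = b ^+ 2 *: W.
Proof.
move=> xS p e; apply: (alt_rep_inj rhoP xS).
rewrite -mulmxA (alt_repVl rhoP) // mulmx1 -scalemxAl e scalerA -exprSr.
by rewrite prim3_cube // scale1r.
Qed.

(** Conjugation by [g] turns [x] into its inverse, which has eigenvalue b^-1 = b^2 on the same
    vectors. *)
Lemma eig_swap x g b : alt_on S x -> alt_on S g -> (x ^ g = x^-1)%g -> prim3 b ->
  (eigenspace (rho x) b *m rho g <= eigenspace (rho x) (b ^+ 2))%MS.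
Proof.
move=> xS gS xg p; apply/eigenspaceP; rewrite -mulmxA -(alt_repM rhoP) //.
have -> : (g * x = x^-1 * g)%g.
  by rewrite [RHS]conjgC conjVg xg invgK.
rewrite (alt_repM rhoP) ?alt_onV // mulmxA.
by rewrite (eigV xS p (eigenspace_mul _ _)) scalemxAl.
Qed.

(** The transposition (a b) already inverts the 3-cycle; (p q) only restores the parity. *)
Lemma cyc3_invJ (a b c p q : T) : uniq [:: a; b; c; p; q] ->
  (cyc3 a b c ^ dtr a b p q = (cyc3 a b c)^-1)%g.
Proof.
move=> U; rewrite cyc3V; last by split_neq U; rewrite /= !inE; decide_eqs.
by rewrite cyc3J; split_neq U; rewrite /cyc3 /dtr; perm_eval; perm_cases.
Qed.

Lemma commute_cyc3 (S' : {set T}) a b c g : perm_on S' g ->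
  a \notin S' -> b \notin S' -> c \notin S' -> commute (cyc3 a b c) g.
Proof.
move=> gS aS bS cS; have h x : x \notin S' -> g x = x by apply: out_perm.
by rewrite /commute [LHS]conjgC cyc3J !h.
Qed.

Lemma mem_alt_on_dtr (S' : {set T}) a b p q : a != b -> p != q ->
  a \in S' -> b \in S' -> p \in S' -> q \in S' -> alt_on S' (dtr a b p q).
Proof.
by move=> ab pq aS bS pS qS; apply: alt_on_dtr => // x; rewrite !inE => /or4P[] /eqP->.
Qed.

(** Even permutations of the points left by x = (a b c) commute with x and preserve its two
    nontrivial eigenspaces. If all were trivial on one of these, y = (p q r) would fix both: [sg]
    inverts x, hence exchanges the eigenspaces, and conjugates y into another such permutation. Then
    [eig3_fix] would give (x - 1)(y - 1) = 0. *)
Lemma disjoint_step m a b c p q r (w : F) : prim3 w ->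
    uniq [:: a; b; c; p; q; r] -> {subset [:: a; b; c; p; q; r] <= S} ->
    (rho (cyc3 a b c) - 1%:M) *m (rho (cyc3 p q r) - 1%:M) != 0 ->
    (forall d' (rho' : {perm T} -> 'M[F]_d'), alt_rep (S :\: [set a; b; c]) rho' ->
       rep_nontriv (S :\: [set a; b; c]) rho' -> (m <= d')%N) ->
  (m + m <= d)%N.
Proof.
move=> pw U sS XY bound; set S' := S :\: [set a; b; c] in bound.
have [aS bS cS] : [/\ a \in S, b \in S & c \in S].
  by split; apply: sS; rewrite !inE eqxx ?orbT.
have [pS qS rS] : [/\ p \in S, q \in S & r \in S].
  by split; apply: sS; rewrite !inE eqxx ?orbT.
have U3 : uniq [:: a; b; c] by split_neq U; rewrite /= !inE; decide_eqs.
have U5 : uniq [:: a; b; c; p; q] by split_neq U; rewrite /= !inE; decide_eqs.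
have s3 : {subset [:: a; b; c] <= S} by move=> x; rewrite !inE => /or3P[] /eqP->.
have sS' : S' \subset S by apply: subsetDl.
have [aS' bS' cS'] : [/\ a \notin S', b \notin S' & c \notin S'].
  by rewrite !inE !eqxx ?orbT.
split_neq U.
have [pS' qS' rS'] : [/\ p \in S', q \in S' & r \in S'].
  by rewrite !inE pS qS rS; decide_eqs.
set x := cyc3 a b c in XY *; set X := rho x in XY *.
have xS : alt_on S x := alt_on_cyc3 U3 s3.
have X3 : X *m X *m X = 1%:M := rho_cyc3_cube U3 s3.
pose sg := dtr a b p q; have sgS : alt_on S sg by apply: mem_alt_on_dtr.
have yS' : alt_on S' (cyc3 p q r) by apply: mem_alt_on_cyc3.
pose y' := (cyc3 p q r ^ sg)%g.
have y'S : alt_on S' y'.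
  have -> : y' = cyc3 q p r by rewrite /y' cyc3J /sg /dtr; perm_eval.
  by apply: mem_alt_on_cyc3; rewrite // eq_sym.
have stable al g : alt_on S' g -> (eigenspace X al *m rho g <= eigenspace X al)%MS.
  move=> gS'; apply: eig_comm => //; first exact: alt_on_sub gS'.
  by case/andP: gS' => gS' _; apply: commute_cyc3 gS' _ _ _.
have key al : prim3 al -> (m <= \rank (eigenspace X al))%N.
  move=> pal.
  have [rho' [rho'P tr]] := subrep_exists (alt_rep_sub sS' rhoP) (stable al).
  apply: bound rho'P _.
  have [/existsP[g /andP[gS g1]]|/existsPn none] :=
    boolP [exists g, alt_on S' g && (rho' g != 1%:M)]; first by exists g.
  have triv g : alt_on S' g -> eigenspace X al *m rho g = eigenspace X al.
    by move=> gS; apply: tr => //; apply/eqP; move: (none g); rewrite gS negbK.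
  case/negP: XY; rewrite mulmxBr mulmx1 subr_eq0; apply/eqP.
  apply: (eig3_fix F_char0 X3 pal); first exact: triv.
  have := eig_swap xS sgS (cyc3_invJ U5) (prim3_conj pal).
  rewrite prim3_4 // => /submxP[C eC].
  apply: (alt_rep_inj rhoP sgS); rewrite -mulmxA.
  rewrite -(alt_repJ rhoP) ?(alt_on_sub sS' yS') // mulmxA eC -mulmxA.
  by rewrite triv.
have neq := prim3_neq F_char0 pw.
have := rank_eig2 neq (submx_refl (eigenspace X w))
  (submx_refl (eigenspace X (w ^+ 2))) (submx1 _) (submx1 _).
rewrite mxrank1; apply: leq_trans; apply: leq_add; apply: key => //.
exact: prim3_conj.
Qed.

(** The two nontrivial eigenspaces are exchanged by an element inverting the 3-cycle, so if one
    vanishes both do, and the 3-cycle acts trivially. *)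
Lemma eig3_neq0 a b c p q (w : F) : prim3 w ->
    uniq [:: a; b; c; p; q] -> {subset [:: a; b; c; p; q] <= S} ->
  rho (cyc3 a b c) != 1%:M -> eigenspace (rho (cyc3 a b c)) w != 0.
Proof.
move=> pw U5 sS; apply: contraNneq => W0.
have [aS bS cS] : [/\ a \in S, b \in S & c \in S].
  by split; apply: sS; rewrite !inE eqxx ?orbT.
have [pS qS] : p \in S /\ q \in S.
  by split; apply: sS; rewrite !inE eqxx ?orbT.
have U3 : uniq [:: a; b; c] by split_neq U5; rewrite /= !inE; decide_eqs.
have s3 : {subset [:: a; b; c] <= S} by move=> x; rewrite !inE => /or3P[] /eqP->.
have X3 := rho_cyc3_cube U3 s3.
have sgS : alt_on S (dtr a b p q) by split_neq U5; apply: mem_alt_on_dtr.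
have := eig_swap (alt_on_cyc3 U3 s3) sgS (cyc3_invJ U5) (prim3_conj pw).
rewrite prim3_4 // W0 submx0 => /eqP h.
have W20 : eigenspace (rho (cyc3 a b c)) (w ^+ 2) = 0.
  by apply: (alt_rep_inj rhoP sgS); rewrite h mul0mx.
have := @eig3_fix _ F_char0 _ _ X3 w 0 pw; rewrite W0 W20 !mulmx0.
by move=> /(_ erefl erefl)/eqP; rewrite eq_sym subr_eq0.
Qed.

End Eigenspaces.

(** * Degree six *)

Section Alt6.
Variables (T : finType) (F : fieldType) (d : nat) (S : {set T}).
Variable rho : {perm T} -> 'M[F]_d.
Hypothesis F_char0 : forall n, n.+1%:R != 0 :> F.
Hypothesis rhoP : alt_rep S rho.

Lemma klein_trivial_rho (r s t : {perm T}) :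
    alt_on S r -> alt_on S s -> alt_on S t ->
    (s * s = 1 -> t * t = 1 -> s * t = t * s -> s ^ r = t -> t ^ r = s * t ->
    1%:M + rho r + rho r *m rho r = 0%R -> rho s = 1%:M)%g.
Proof.
move=> rS sS tS ss tt st sr tr r0.
have M := alt_repM rhoP.
apply: (@klein_trivial _ _ (rho r) (rho s) (rho t) (F_char0 3)) => //.
- by rewrite -[LHS]M // ss (alt_rep1 rhoP).
- by rewrite -[LHS]M // tt (alt_rep1 rhoP).
- by rewrite -[LHS]M // -[RHS]M // st.
- by rewrite -[LHS]M // -[RHS]M // -sr -conjgC.
- by rewrite -mulrA -[LHS]M // -[X in _ = _ * X]M // -[RHS]M ?alt_onM // -tr -conjgC.
Qed.

(* If x = (a b c) and y = (p q r) satisfy (x - 1)(y - 1) = 0, then xy has no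
   fixed vector in dimension 4; otherwise x itself has none. Either element of
   order 3 belongs to a copy of A_4, whose Klein subgroup is then trivial. *)
Lemma alt6_rep_bound (w : F) : prim3 w -> #|S| = 6 -> rep_nontriv S rho -> (5 <= d)%N.
Proof.
move=> pw cS nt; have cS5 : (5 <= #|S|)%N by rewrite cS.
rewrite ltnNge; apply/negP=> d4; move: cS.
rewrite cardE; case E: (enum S) => [|a [|b [|c [|p [|q [|r []]]]]]] // _.
have [U sS] := enum_set_uniq (esym E).
have [aS bS cS] : [/\ a \in S, b \in S & c \in S].
  by split; apply: sS; rewrite !inE eqxx ?orbT.
have [pS qS rS] : [/\ p \in S, q \in S & r \in S].
  by split; apply: sS; rewrite !inE eqxx ?orbT.
have pw2 := prim3_conj pw; have w4 := prim3_4 pw; have neq := prim3_neq F_char0 pw.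
split_neq U.
have Ux : uniq [:: a; b; c] by rewrite /= !inE; decide_eqs.
have Uy : uniq [:: p; q; r] by rewrite /= !inE; decide_eqs.
have Ux5 : uniq [:: a; b; c; p; q] by rewrite /= !inE; decide_eqs.
have Uy5 : uniq [:: p; q; r; a; b] by rewrite /= !inE; decide_eqs.
have sx : {subset [:: a; b; c] <= S} by move=> x; rewrite !inE => /or3P[] /eqP->.
have sy : {subset [:: p; q; r] <= S} by move=> x; rewrite !inE => /or3P[] /eqP->.
have sx5 : {subset [:: a; b; c; p; q] <= S}.
  by move=> x; rewrite !inE => /or4P[] => [||| /orP[]] /eqP->.
have sy5 : {subset [:: p; q; r; a; b] <= S}.
  by move=> x; rewrite !inE => /or4P[] => [||| /orP[]] /eqP->.
pose x := cyc3 a b c; pose y := cyc3 p q r.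
have xS : alt_on S x := alt_on_cyc3 Ux sx.
have yS : alt_on S y := alt_on_cyc3 Uy sy.
have xyC : commute x y.
  have /andP[yon _] : alt_on [set p; q; r] y.
    by apply: mem_alt_on_cyc3; rewrite ?inE ?eqxx ?orbT.
  by apply: commute_cyc3 yon _ _ _; rewrite !inE; decide_eqs.
pose X := rho x; pose Y := rho y.
have XYC : X *m Y = Y *m X := alt_rep_comm rhoP xS yS xyC.
have X3 : X *m X *m X = 1%:M := rho_cyc3_cube rhoP Ux sx.
have Y3 : Y *m Y *m Y = 1%:M := rho_cyc3_cube rhoP Uy sy.
have X1 : X != 1%:M := cyc3_nontriv rhoP cS5 nt Ux sx.
have Y1 : Y != 1%:M := cyc3_nontriv rhoP cS5 nt Uy sy.
have kill0 (Z : 'M[F]_d) : Z *m Z *m Z = 1%:M -> (Z - 1%:M) *m (1%:M + Z + Z *m Z) = 0.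
  by move=> Z3; rewrite !mulmxDr mulmx1 mulmxA; apply: cube_kill.
have eig_kill0 (Z : 'M[F]_d) u : prim3 u -> eigenspace Z u *m (1%:M + Z + Z *m Z) = 0.
  move=> pu; rewrite !mulmxDr mulmx1 mulmxA eigenspace_mul -scalemxAl eigenspace_mul.
  rewrite scalerA -{1}[eigenspace Z u]scale1r -!scalerDl -expr2.
  by rewrite addrC [1 + u]addrC addrA pu scale0r.
(* Since d <= 4, rank at least 4 means that A and B together span the whole space. *)
have full (A B C : 'M[F]_d) : (4 <= \rank (A + B)%MS)%N ->
    A *m C = 0 -> B *m C = 0 -> C = 0.
  move=> rAB AC BC; have AB1 : (1%:M <= A + B)%MS.
    rewrite sub1mx -col_leq_rank; exact: leq_trans d4 rAB.
  have : (1%:M <= kermx C)%MS.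
    by apply: submx_trans AB1 _; rewrite addsmx_sub; apply/andP; split; apply/sub_kermxP.
  by move/sub_kermxP; rewrite mul1mx.
have [XY0|XY0] := eqVneq ((X - 1%:M) *m (Y - 1%:M)) 0.
  pose Z := rho (x * y)%g; have ZE : Z = X *m Y := alt_repM rhoP xS yS.
  have XY : (X - 1%:M) *m Y = X - 1%:M.
    by apply/eqP; rewrite -subr_eq0 -XY0 mulmxBr mulmx1.
  have YX0 : (Y - 1%:M) *m (X - 1%:M) = 0.
    rewrite -[RHS]XY0 !mulmxBl !mulmxBr !mul1mx !mulmx1 XYC.
    by move: (Y *m X) => V; mx_linear.
  have YX : (Y - 1%:M) *m X = Y - 1%:M.
    by apply/eqP; rewrite -subr_eq0 -YX0 mulmxBr mulmx1.
  have rk_im (V : 'M[F]_d) : eigenspace V w != 0 -> eigenspace V (w ^+ 2) != 0 ->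
      (2 <= \rank (V - 1%:M)%R)%N.
    move=> V1 V2.
    have im u : prim3 u -> (eigenspace V u <= (V - 1%:M)%R)%MS.
      move=> pu; apply/submxP; exists ((u - 1)^-1 *: eigenspace V u).
      rewrite -scalemxAl mulmxBr mulmx1 eigenspace_mul.
      have -> : u *: eigenspace V u - eigenspace V u = (u - 1) *: eigenspace V u.
        by rewrite scalerBl scale1r.
      by rewrite scalerA mulVf ?scale1r // subr_eq0 (prim3_neq1 F_char0).
    apply: leq_trans (rank_eig2 neq (submx_refl _) (submx_refl _) (im _ pw) (im _ pw2)).
    by rewrite -[2%N]/(1 + 1)%N leq_add // lt0n mxrank_eq0.
  (* The images of X - 1 and Y - 1 meet in 0 and each has rank at least 2, so they fill the space.
     On the first Y is the identity and Z acts as X; on the second the roles are exchanged. *)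
  have Z0 : 1%:M + Z + Z *m Z = 0.
    apply: (full (X - 1%:M) (Y - 1%:M)).
    - have cap0 : ((X - 1%:M)%R :&: (Y - 1%:M)%R = 0)%MS.
        apply/eqP; rewrite -submx0; apply/rV_subP=> v; rewrite sub_capmx.
        case/andP=> /submxP[u ->] /submxP[u' e]; rewrite e submx0; apply/eqP.
        have vY : u' *m (Y - 1%:M) *m Y = u' *m (Y - 1%:M) by rewrite -e -mulmxA XY.
        have := cube_kill Y3 (submxMl u' _); rewrite !vY -mulr2n -mulrSr.
        exact: (@regM _ F_char0 _ _ _ 2).
      rewrite mxrank_disjoint_sum // -[4%N]/(2 + 2)%N leq_add //; apply: rk_im.
      + exact: (eig3_neq0 F_char0 rhoP pw Ux5 sx5).
      + exact: (eig3_neq0 F_char0 rhoP pw2 Ux5 sx5).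
      + exact: (eig3_neq0 F_char0 rhoP pw Uy5 sy5).
      + exact: (eig3_neq0 F_char0 rhoP pw2 Uy5 sy5).
    - have e : (X - 1%:M) *m Z = (X - 1%:M) *m X by rewrite ZE XYC mulmxA XY.
      have eX : (X - 1%:M) *m X = X *m (X - 1%:M) by rewrite mulmxBl mulmxBr mulmx1 mul1mx.
      rewrite -(kill0 _ X3) !mulmxDr mulmxA e; congr (_ + _).
      by rewrite {1}eX -mulmxA e mulmxA -eX mulmxA.
    - have e : (Y - 1%:M) *m Z = (Y - 1%:M) *m Y by rewrite ZE mulmxA YX.
      have eY : (Y - 1%:M) *m Y = Y *m (Y - 1%:M) by rewrite mulmxBl mulmxBr mulmx1 mul1mx.
      rewrite -(kill0 _ Y3) !mulmxDr mulmxA e; congr (_ + _).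
      by rewrite {1}eY -mulmxA e mulmxA -eY mulmxA.
  have U4 : uniq [:: a; p; b; q] by rewrite /= !inE; decide_eqs.
  have s4 : {subset [:: a; p; b; q] <= S} by move=> z; rewrite !inE => /or4P[] /eqP->.
  have /eqP := dtr_nontriv rhoP cS5 nt U4 s4; apply.
  (* The element xy permutes (a p), (b q), (c r) cyclically; with the products of two of these it
     generates a copy of A_4. *)
  apply: (@klein_trivial_rho (x * y)%g _ (dtr b q c r)) => //.
  - exact: alt_onM.
  - exact: mem_alt_on_dtr.
  - exact: mem_alt_on_dtr.
  1,2,3: by rewrite /dtr; perm_cases.
  - rewrite dtrJ /x /y /cyc3 /dtr. perm_eval; by perm_cases.
  - by rewrite dtrJ /x /y /cyc3 /dtr; perm_eval; perm_cases.
have E_swap al be : prim3 al -> prim3 be ->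
    (eigenspace X al :&: eigenspace Y be)%MS != 0 ->
    (eigenspace X (be ^+ 2) :&: eigenspace Y al)%MS != 0.
  move=> pal pbe; apply: contraNneq => E0.
  (* The first three factors exchange x and y and the last one inverts x, so x goes to y and y to
     x^-1; four transpositions make [g] even. It carries the joint eigenvalues (al, be) to (be^2,
     al). *)
  pose g := (tperm a p * tperm b q * tperm c r * tperm a b)%g.
  have gS : alt_on S g.
    rewrite /alt_on !perm_onM ?perm_on_tperm //= !odd_permM !odd_tperm.
    by decide_eqs.
  have xg : (x ^ g = y)%g by rewrite /x cyc3J /g; perm_eval.
  have yg : (y ^ g = x^-1)%g.
    by rewrite /y cyc3J /x cyc3V // /g; perm_eval; rewrite /cyc3; perm_cases.
  set W := (eigenspace X al :&: eigenspace Y be)%MS.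
  have WX : W *m X = al *: W by apply/eigenspaceP; apply: capmxSl.
  have WY : W *m Y = be *: W by apply/eigenspaceP; apply: capmxSr.
  apply/eqP/(alt_rep_inj rhoP gS); rewrite mul0mx; apply/eqP.
  rewrite -submx0 -E0 sub_capmx; apply/andP; split; apply/eigenspaceP.
    have e := alt_repJ rhoP (alt_onV yS) gS.
    rewrite conjVg yg invgK in e.
    by rewrite -mulmxA e mulmxA (eigV rhoP yS pbe WY) scalemxAl.
  have e := alt_repJ rhoP xS gS; rewrite xg in e.
  by rewrite -mulmxA e mulmxA WX scalemxAl.
(* As (X - 1)(Y - 1) is nonzero, some joint eigenspace for nontrivial eigenvalues is nonzero; if its
   two eigenvalues differ, [E_swap] makes them equal. *)
have [al [pal Eaa]] : exists al : F, prim3 al /\ (eigenspace X al :&: eigenspace Y al)%MS != 0.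
  have E_ne al be : prim3 al -> prim3 be -> proj3 X al *m proj3 Y be != 0 ->
      (eigenspace X al :&: eigenspace Y be)%MS != 0.
    move=> pal pbe; apply: contraNneq => E0; rewrite -submx0 -E0 sub_capmx.
    apply/andP; split; apply/eigenspaceP; last first.
      by rewrite -mulmxA proj3_eig // scalemxAr.
    have <- : proj3 X al *m X *m proj3 Y be = proj3 X al *m proj3 Y be *m X.
      rewrite -!mulmxA; congr (_ *m _).
      rewrite /proj3 !(mulmxDl, mulmxDr) mul1mx mulmx1 -!scalemxAl -!scalemxAr.
      have -> : X *m (Y *m Y) = Y *m Y *m X by rewrite mulmxA XYC -mulmxA XYC mulmxA.
      by rewrite XYC.
    by rewrite proj3_eig // scalemxAl.
  have [h1|h1] := eqVneq (proj3 X w *m proj3 Y w) 0; last by exists w; split=> //; apply: E_ne.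
  have [h2|h2] := eqVneq (proj3 X (w ^+ 2) *m proj3 Y (w ^+ 2)) 0; last first.
    by exists (w ^+ 2); split=> //; apply: E_ne.
  have [h3|h3] := eqVneq (proj3 X w *m proj3 Y (w ^+ 2)) 0; last first.
    by exists w; split=> //; rewrite -{1}w4; apply: E_swap => //; apply: E_ne.
  have [h4|h4] := eqVneq (proj3 X (w ^+ 2) *m proj3 Y w) 0; last first.
    by exists (w ^+ 2); split=> //; apply: E_swap => //; apply: E_ne.
  case/eqP: XY0; apply: (@regM _ F_char0 _ _ _ 2); apply: (@regM _ F_char0 _ _ _ 2).
  have eY : (proj3 Y w + proj3 Y (w ^+ 2)) *m (Y - 1%:M) = (Y - 1%:M) *+ 3.
    rewrite -(proj3_sum Y3 pw) /proj3 !(mulmxDl, mulmxDr, mulmxBl, mulmxBr).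
    rewrite -!scalemxAl -!scalemxAr !(mulmxN, mulNmx, mul1mx, mulmx1) !mulmxA.
    by move: (Y *m Y *m Y) (Y *m Y) => ? ?; mx_linear.
  transitivity ((X - 1%:M) *+ 3 *m ((Y - 1%:M) *+ 3)).
    by rewrite -[RHS]/(_ * _) mulrnAl mulrnAr.
  rewrite -(proj3_sum X3 pw) -eY.
  have PQ0 : (proj3 X w + proj3 X (w ^+ 2)) *m (proj3 Y w + proj3 Y (w ^+ 2)) = 0.
    move: (proj3 X w) (proj3 X (w ^+ 2)) (proj3 Y w) (proj3 Y (w ^+ 2)) h1 h2 h3 h4.
    by move=> P P' Q Q' h1 h2 h3 h4; rewrite mulmxDl !mulmxDr h1 h2 h3 h4 !addr0.
  by rewrite mulmxA -(mulmxA (X - 1%:M)) PQ0 mulmx0 mul0mx.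
have pal2 := prim3_conj pal; have al4 := prim3_4 pal.
(* From (al, al) one reaches (al^2, al), (al^2, al^2) and (al, al^2), so both nontrivial eigenspaces
   of X have dimension at least 2. *)
have E2 := E_swap _ _ pal pal Eaa.
have E3 := E_swap _ _ pal2 pal E2.
have E4 := E_swap _ _ pal2 pal2 E3; rewrite al4 in E4.
have neqa := prim3_neq F_char0 pal.
have rk be : (eigenspace X be :&: eigenspace Y al)%MS != 0 ->
    (eigenspace X be :&: eigenspace Y (al ^+ 2))%MS != 0 ->
    (2 <= \rank (eigenspace X be))%N.
  move=> V1 V2.
  apply: leq_trans (rank_eig2 (X := Y) neqa (capmxSr _ _) (capmxSr _ _) (capmxSl _ _) (capmxSl _ _)).
  by rewrite -[2%N]/(1 + 1)%N leq_add // lt0n mxrank_eq0.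
have X0 : 1%:M + X + X *m X = 0.
  apply: (full (eigenspace X al) (eigenspace X (al ^+ 2))).
2,3: exact: eig_kill0.
  apply: leq_trans (rank_eig2 neqa (submx_refl _) (submx_refl _) (addsmxSl _ _) (addsmxSr _ _)).
  by rewrite -[4%N]/(2 + 2)%N leq_add // rk //.
have U4 : uniq [:: a; p; b; c] by rewrite /= !inE; decide_eqs.
have s4 : {subset [:: a; p; b; c] <= S} by move=> z; rewrite !inE => /or4P[] /eqP->.
have /eqP := dtr_nontriv rhoP cS5 nt U4 s4; apply.
(* This copy of A_4 is the alternating group of {a, b, c, p}. *)
apply: (@klein_trivial_rho x _ (dtr b p c a)) => //.
- exact: mem_alt_on_dtr.
- by apply: mem_alt_on_dtr; rewrite // eq_sym.
1,2,3: by rewrite /dtr; perm_cases.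
- by rewrite dtrJ /x /y /cyc3 /dtr; perm_eval; perm_cases.
- by rewrite dtrJ /x /y /cyc3 /dtr; perm_eval; perm_cases.
Qed.
End Alt6.

(** * The standard representation *)

Lemma avoid_seq (T : finType) (S : {set T}) (s : seq T) :
  (size s < #|S|)%N -> exists2 x, x \in S & x \notin s.
Proof.
move=> lt; apply/subsetPn; apply: contraL lt => /subset_leq_card h.
by rewrite -leqNgt; apply: leq_trans h (card_size s).
Qed.

(* W i j plays the role of the root e_i - e_j of the standard representation. *)
Section RootVectors.
Variables (T : finType) (F : fieldType) (d : nat) (S : {set T}).
Variables (rho : {perm T} -> 'M[F]_d) (W : T -> T -> 'rV[F]_d).
Hypothesis F_char0 : forall n, n.+1%:R != 0 :> F.
Hypothesis cS : (7 <= #|S|)%N.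
Hypothesis W_act : forall h i j, alt_on S h -> i \in S -> j \in S -> i != j ->
  W i j *m rho h = W (h i) (h j).
Hypothesis W_anti : forall i j, i \in S -> j \in S -> i != j -> W j i = - W i j.
Hypothesis W_cyc : forall i j k, i \in S -> j \in S -> k \in S ->
  i != j -> j != k -> k != i -> W i j + W j k + W k i = 0.
Hypothesis W_neq0 : forall i j, i \in S -> j \in S -> i != j -> W i j != 0.

Lemma root_sub a p q : a \in S -> p \in S -> q \in S -> a != p -> a != q -> p != q ->
  W a q - W a p = W p q.
Proof.
move=> aS pS qS ap aq pq.
have := W_cyc aS pS qS ap pq; rewrite eq_sym => /(_ aq).
rewrite (W_anti aS qS aq) => /eqP; rewrite subr_eq0 => /eqP <-.
by rewrite addrC addKr.
Qed.

(** A 3-cycle (r t u) fixing p and q changes only the second term; the difference of the relation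
    and its image is be W r t = 0. *)
Lemma root_indep2 p q r (al be : F) : p \in S -> q \in S -> r \in S ->
  uniq [:: p; q; r] -> al *: W p q + be *: W q r = 0 -> al = 0 /\ be = 0.
Proof.
move=> pS qS rS U e.
have [t tS tn] : exists2 t, t \in S & t \notin [:: p; q; r].
  by apply: avoid_seq; apply: leq_trans cS.
have [u uS un] : exists2 u, u \in S & u \notin [:: t; p; q; r].
  by apply: avoid_seq; apply: leq_trans cS.
have U5 : uniq [:: u; t; p; q; r].
  by rewrite [uniq _]/(_ && uniq [:: t; p; q; r]) un [uniq _]/(_ && uniq [:: p; q; r]) tn U.
split_neq U5.
have hS : alt_on S (cyc3 r t u) by apply: mem_alt_on_cyc3; rewrite // eq_sym.
have := congr1 (mulmx^~ (rho (cyc3 r t u))) e.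
rewrite mul0mx mulmxDl -!scalemxAl !W_act //.
have -> : cyc3 r t u p = p by rewrite /cyc3; perm_eval.
have -> : cyc3 r t u q = q by rewrite /cyc3; perm_eval.
have -> : cyc3 r t u r = t by rewrite /cyc3; perm_eval.
rewrite -[X in _ = X]e => /addrI/eqP.
have [qt rt] : q != t /\ r != t by rewrite ![_ == t]eq_sym.
rewrite -subr_eq0 -scalerBr root_sub // scaler_eq0.
rewrite (negbTE (W_neq0 _ _ _)) // orbF => /eqP be0.
move/eqP: e; rewrite be0 scale0r addr0 scaler_eq0 (negbTE (W_neq0 _ _ _)) // orbF.
by move/eqP.
Qed.

Lemma root_indep a (c : T -> F) : a \in S ->
  \sum_(j in S :\ a) c j *: W a j = 0 -> forall j, j \in S :\ a -> c j = 0.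
Proof.
move=> aS e.
have aD j : j \in S :\ a -> a != j by rewrite !inE eq_sym => /andP[].
have DS j : j \in S :\ a -> j \in S by rewrite !inE => /andP[].
(* Comparing the relation with its image under (p q r) leaves c_p W p q + c_q W q r + c_r W r p = 0.
   Eliminating W r p gives a relation between two independent vectors, whose first coefficient is
   c_p - c_r. *)
have const p r : p \in S :\ a -> r \in S :\ a -> c p = c r.
  move=> pD rD; have [->//|pr] := eqVneq p r.
  have [q qD qn] : exists2 q, q \in S :\ a & q \notin [:: p; r].
    by apply: avoid_seq; rewrite -ltnS; move: cS; rewrite (cardsD1 a S) aS; apply: leq_trans.
  rewrite !inE negb_or in qn; case/andP: qn => qp qr.
  have [ap aq ar] : [/\ a != p, a != q & a != r] by rewrite !aD.
  have [pS qS rS] : [/\ p \in S, q \in S & r \in S] by rewrite !DS.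
  have pq : p != q by rewrite eq_sym.
  have rp : r != p by rewrite eq_sym.
  have hS : alt_on S (cyc3 p q r) by apply: mem_alt_on_cyc3.
  have ha : cyc3 p q r a = a by rewrite /cyc3; perm_eval.
  have := congr1 (mulmx^~ (rho (cyc3 p q r))) e.
  rewrite mul0mx mulmx_suml -[X in _ = X]e => /eqP; rewrite -subr_eq0 -sumrB.
  rewrite (bigD1 p) //= (bigD1 q) /=; last by rewrite qD.
  rewrite (bigD1 r) /=; last by rewrite rD rp eq_sym.
  rewrite big1 => [|j /andP[/andP[/andP[jD jp] jq] jr]]; last first.
    have [jS aj] := (DS j jD, aD j jD).
    rewrite -scalemxAl W_act // ha.
    have -> : cyc3 p q r j = j by rewrite /cyc3; perm_eval.
    by rewrite subrr.
  rewrite addr0 -!scalemxAl !W_act // ha.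
  have -> : cyc3 p q r p = q by rewrite /cyc3; perm_eval.
  have -> : cyc3 p q r q = r by rewrite /cyc3; perm_eval.
  have -> : cyc3 p q r r = p by rewrite /cyc3; perm_eval.
  rewrite -!scalerBr !root_sub // => /eqP e3.
  have U : uniq [:: p; q; r] by rewrite /= !inE; decide_eqs.
  have e2 : (c p - c r) *: W p q + (c q - c r) *: W q r = 0.
    have erp : W r p = - (W p q + W q r).
      by apply/eqP; rewrite -addr_eq0 [X in X == _]addrC W_cyc.
    by rewrite -[RHS]e3 erp; mx_linear.
  have [/eqP + _] := root_indep2 pS qS rS U e2.
  by rewrite subr_eq0 => /eqP.
move=> j jD; apply/eqP; apply: contraT => cj.
have sum0 : \sum_(k in S :\ a) W a k = 0.
  apply/eqP; move/eqP: e.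
  rewrite (eq_bigr (fun k => c j *: W a k)) => [|k kD]; last by rewrite (const k j).
  by rewrite -scaler_sumr scaler_eq0 (negbTE cj).
have [jS aj] := (DS j jD, aD j jD).
have sum0j : \sum_(k in S :\ j) W j k = 0.
  have [k0 k0S] : exists2 k, k \in S & k \notin [:: a; j].
    by apply: avoid_seq; apply: leq_trans cS.
  have [k1 k1S] : exists2 k, k \in S & k \notin [:: k0; a; j].
    by apply: avoid_seq; apply: leq_trans cS.
  rewrite !inE !negb_or => /and3P[n1 n2 n3] /andP[n4 n5].
  have gS : alt_on S (dtr a j k0 k1) by apply: mem_alt_on_dtr; rewrite // eq_sym.
  have := congr1 (mulmx^~ (rho (dtr a j k0 k1))) sum0.
  rewrite mul0mx mulmx_suml => e0; rewrite -[RHS]e0.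
  have ga : dtr a j k0 k1 a = j by rewrite /dtr; perm_eval.
  rewrite (reindex_inj (@perm_inj _ (dtr a j k0 k1))).
  have DgE k : (dtr a j k0 k1 k \in S :\ j) = (k \in S :\ a).
    case/andP: gS => gS _.
    by rewrite !inE perm_closed // -{2}ga (inj_eq perm_inj).
  apply: eq_big => k; first exact: DgE.
  rewrite DgE => kD; have [kS ak] := (DS k kD, aD k kD).
  by rewrite W_act // ga.
have := W_neq0 aS jS aj; case/eqP.
(* Each k other than a and j contributes W a k - W j k = W a j; the terms W a j and - W j a add two
   more, in all #|S| copies. *)
have eT : \sum_(k in S :\ a) W a k - \sum_(k in S :\ j) W j k = W a j *+ #|S|.
  rewrite (bigD1 j) //= [X in _ - X](bigD1 a) /=; last by rewrite !inE aj aS.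
  rewrite (W_anti aS jS aj).
  have -> : \sum_(k in S :\ j | k != a) W j k = \sum_(k in S :\ a | k != j) W j k.
    by apply: eq_bigl => k; rewrite !inE; case: (k == a) (k == j) (k \in S) => [] [] [].
  rewrite opprD opprK addrACA -sumrB.
  rewrite (eq_bigr (fun=> W a j)) => [|k /andP[kD kj]]; last first.
    have [kS ak] := (DS k kD, aD k kD); have jk : j != k by rewrite eq_sym.
    by rewrite -(root_sub aS jS kS aj ak jk) opprB addrC subrK.
  rewrite (eq_bigl (mem (S :\ a :\ j))) => [|k]; last by rewrite !inE andbC.
  rewrite sumr_const -mulr2n -mulrnDr; congr (_ *+ _).
  by rewrite (cardsD1 a S) aS (cardsD1 j (S :\ a)) jD.
move: eT; rewrite sum0 sum0j subrr => /esym.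
case: #|S| cS => // m _; exact: regM.
Qed.

Lemma root_bound : (#|S|.-1 <= d)%N.
Proof.
have [a aS] : exists a, a \in S by apply/card_gt0P; apply: leq_trans cS.
have -> : #|S|.-1 = #|S :\ a| by rewrite (cardsD1 a S) aS.
pose M := \matrix_(i < #|S :\ a|) W a (enum_val i).
have [b bD] : exists b, b \in S :\ a.
  by apply/card_gt0P; rewrite -ltnS; move: cS; rewrite (cardsD1 a S) aS; apply: leq_trans.
suff : row_free M by rewrite /row_free => /eqP <-; apply: rank_leq_col.
rewrite -kermx_eq0; apply/rowV0P=> c /sub_kermxP cM.
pose c' j := c 0 (enum_rank_in bD j).
have e : \sum_(j in S :\ a) c' j *: W a j = 0.
  rewrite -[RHS]cM big_enum_val mulmx_sum_row; apply: eq_bigr => i _.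
  by rewrite rowK /c' enum_valK_in.
apply/rowP=> i; rewrite mxE -[i](enum_valK_in bD).
exact: (root_indep aS e (enum_valP i)).
Qed.

End RootVectors.

(** * Construction of root vectors when (x - 1)(y - 1) = 0 for disjoint 3-cycles *)

Section StandardCase.
Variables (T : finType) (F : fieldType) (d : nat) (S : {set T}).
Variable rho : {perm T} -> 'M[F]_d.
Hypothesis F_char0 : forall n, n.+1%:R != 0 :> F.
Hypothesis rhoP : alt_rep S rho.
Hypothesis cS : (7 <= #|S|)%N.
Hypothesis nt : rep_nontriv S rho.
Hypothesis disj : forall a b c p q r, uniq [:: a; b; c; p; q; r] ->
  {subset [:: a; b; c; p; q; r] <= S} ->
  (rho (cyc3 a b c) - 1%:M) *m (rho (cyc3 p q r) - 1%:M) = 0.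

Lemma disj_fix a b c g k (w : 'M_(k, d)) : uniq [:: a; b; c] ->
    {subset [:: a; b; c] <= S} ->
    (w <= (rho (cyc3 a b c) - 1%:M)%R)%MS ->
  alt_on (S :\: [set a; b; c]) g -> w *m rho g = w.
Proof.
move=> U sS /submxP[w0 ->].
apply: (fix_cyc3_fix rhoP); first exact: subsetDl.
move=> p q r U' sS'; rewrite -mulmxA; congr (_ *m _).
apply/eqP; rewrite -subr_eq0 -[X in _ - X]mulmx1 -mulmxBr; apply/eqP/disj.
  change (uniq ([:: a; b; c] ++ [:: p; q; r])); rewrite cat_uniq U U' andbT.
  by apply/hasPn=> x /sS'; rewrite !inE => /andP[+ _]; rewrite -orbA.
move=> x; change (x \in [:: a; b; c] ++ [:: p; q; r] -> x \in S); rewrite mem_cat.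
by case/orP=> [/sS//|/sS']; rewrite inE => /andP[].
Qed.

(* The vector w is e_a - e_b up to a scalar: it lies in the image of (a b c) - 1
   and is negated by (a b)(p q). For k = (c p q) the vector w(k - 1) is both
   fixed and negated by (a b)(r s), hence zero, which gives the full stabiliser. *)
Lemma root_exists a b c p q r s : uniq [:: a; b; c; p; q; r; s] ->
    {subset [:: a; b; c; p; q; r; s] <= S} ->
  exists w : 'rV[F]_d, [/\ w != 0, w *m rho (dtr a b p q) = - w,
    w + w *m rho (cyc3 a b c) + w *m rho (cyc3 a b c * cyc3 a b c)%g = 0 &
    forall g, alt_on (S :\: [set a; b]) g -> w *m rho g = w].
Proof.
move=> U sS.
have [aS bS c_S] : [/\ a \in S, b \in S & c \in S].
  by split; apply: sS; rewrite !inE eqxx ?orbT.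
have [pS qS rS sS'] : [/\ p \in S, q \in S, r \in S & s \in S].
  by split; apply: sS; rewrite !inE eqxx ?orbT.
split_neq U.
have Ux : uniq [:: a; b; c] by rewrite /= !inE; decide_eqs.
have Uk : uniq [:: c; p; q] by rewrite /= !inE; decide_eqs.
have U5 : uniq [:: a; b; c; p; q] by rewrite /= !inE; decide_eqs.
have sx : {subset [:: a; b; c] <= S} by move=> x; rewrite !inE => /or3P[] /eqP->.
have sk : {subset [:: c; p; q] <= S} by move=> x; rewrite !inE => /or3P[] /eqP->.
pose x := cyc3 a b c; pose sg := dtr a b p q; pose tau := dtr a b r s.
have xS : alt_on S x := alt_on_cyc3 Ux sx.
have sgS : alt_on S sg by apply: mem_alt_on_dtr.
have tauS : alt_on S tau by apply: mem_alt_on_dtr.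
have sg2 : (sg * sg = 1)%g by rewrite /sg /dtr; perm_cases.
pose X := rho x.
have X3 : X *m X *m X = 1%:M := rho_cyc3_cube rhoP Ux sx.
have X1 : X != 1%:M by apply: (cyc3_nontriv rhoP _ nt Ux sx); apply: leq_trans cS.
have XV : rho x^-1%g = X *m X.
  by apply: (alt_rep_inj rhoP xS); rewrite (alt_repVl rhoP).
have Xsg : X *m rho sg = rho sg *m (X *m X).
  by rewrite -XV -(cyc3_invJ U5) (alt_repJ rhoP).
have sg_im (v : 'rV_d) : (v <= (X - 1%:M)%R)%MS -> (v *m rho sg <= (X - 1%:M)%R)%MS.
  case/submxP=> u ->; apply/submxP; exists (u *m rho sg *m (X + 1%:M)).
  rewrite -!mulmxA; congr (_ *m _).
  rewrite mulmxBl mul1mx Xsg -[X in _ = _ *m X]/((X + 1%:M) *m (X - 1%:M)).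
  have -> : (X + 1%:M) *m (X - 1%:M) = X *m X - 1%:M.
    by rewrite mulmxDl mulmxBr mulmx1 mul1mx; move: (X *m X) => Y; mx_linear.
  by rewrite mulmxBr mulmx1.
have [w [w0 wim wsg]] : exists w : 'rV[F]_d,
    [/\ w != 0, (w <= (X - 1%:M)%R)%MS & w *m rho sg = - w].
  have [u uX1 u0] : exists2 u : 'rV_d, (u <= (X - 1%:M)%R)%MS & u != 0.
    have /rowV0Pn[u uX u0] : X - 1%:M != 0 by rewrite subr_eq0.
    by exists u.
  have good (v : 'rV[F]_d) : (v <= (X - 1%:M)%R)%MS -> v - v *m rho sg != 0 ->
      exists w : 'rV[F]_d, [/\ w != 0, (w <= (X - 1%:M)%R)%MS & w *m rho sg = - w].
    move=> vim v0; exists (v - v *m rho sg); split=> //.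
      by rewrite addmx_sub // eqmx_opp sg_im.
    by rewrite mulmxBl -mulmxA -(alt_repM rhoP) // sg2 (alt_rep1 rhoP) mulmx1 opprB.
  (* A vector v - v sg is negated by sg, so only its vanishing for both v = u and v = uX is to be
     excluded. Since sg inverts X, this would give uX = uX^2, hence u = uX, while 1 + X + X^2 kills
     u: 3u = 0. *)
  have [e1|/(good u uX1)//] := eqVneq (u - u *m rho sg) 0.
  have uXim : (u *m X <= (X - 1%:M)%R)%MS.
    case/submxP: uX1 => v ->; apply/submxP; exists (v *m X).
    by rewrite -!mulmxA; congr (_ *m _); rewrite mulmxBl mulmxBr mulmx1 mul1mx.
  have [e2|/(good _ uXim)//] := eqVneq (u *m X - u *m X *m rho sg) 0.
  case/eqP: u0; apply: (@regM _ F_char0 _ _ _ 2).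
  have us : u *m rho sg = u by apply/esym/eqP; rewrite -subr_eq0 e1.
  have uXX : u *m X = u *m X *m X.
    apply/eqP; rewrite -subr_eq0; apply/eqP; rewrite -[RHS]e2; congr (_ - _).
    by rewrite -(mulmxA u X (rho sg)) Xsg mulmxA us mulmxA.
  have uX : u = u *m X.
    have := congr1 (mulmx^~ X) uXX; rewrite -!mulmxA (mulmxA X X X) X3 mulmx1.
    by rewrite mulmxA -uXX.
  by have := cube_kill X3 uX1; rewrite -!uX -mulr2n -mulrSr.
exists w; split=> //.
  by have := cube_kill X3 wim; rewrite (alt_repM rhoP) // mulmxA.
have fix1 g : alt_on (S :\: [set a; b; c]) g -> w *m rho g = w.
  exact: disj_fix Ux sx wim.
(* The product of [sg] and [tau] is (p q)(r s), which fixes w because it avoids a, b, c; so [tau]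
   negates w as [sg] does. *)
have wtau : w *m rho tau = - w.
  have := fix1 (dtr p q r s); rewrite (_ : dtr p q r s = (sg * tau)%g); last first.
    by rewrite /sg /tau /dtr; perm_cases.
  rewrite (alt_repM rhoP) // mulmxA wsg mulNmx => e.
  rewrite -[LHS]opprK e //.
  have -> : (sg * tau)%g = dtr p q r s by rewrite /sg /tau /dtr; perm_cases.
  by apply: mem_alt_on_dtr; rewrite // !inE ?pS ?qS ?rS ?sS'; decide_eqs.
have fixk : w *m rho (cyc3 c p q) = w.
  set k := cyc3 c p q; have kS : alt_on S k := alt_on_cyc3 Uk sk.
  pose z := w *m (rho k - 1%:M).
  have z1 : z *m rho tau = z.
    apply: (disj_fix Uk sk); first exact: submxMl.
    by apply: mem_alt_on_dtr; rewrite // !inE ?aS ?bS ?rS ?sS'; decide_eqs.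
  have ktau : commute k tau.
    have /andP[ton _] : alt_on [set a; b; r; s] tau.
      by apply: mem_alt_on_dtr; rewrite ?inE ?eqxx ?orbT.
    by apply: commute_cyc3 ton _ _ _; rewrite !inE; decide_eqs.
  have z2 : z *m rho tau = - z.
    rewrite /z -mulmxA mulmxBl mul1mx (alt_rep_comm rhoP kS tauS ktau) mulmxBr.
    by rewrite mulmxA wtau mulNmx opprK mulmxBr mulmx1 opprB addrC.
  have z0 : z = 0.
    apply: (@regM _ F_char0 _ _ _ 1); rewrite mulr2n.
    by rewrite -{1}z1 z2 addNr.
  by apply/eqP; rewrite -subr_eq0 -[X in _ - X]mulmx1 -mulmxBr -/z z0.
apply: (fix_cyc3_fix rhoP); first exact: subsetDl.
(* Every 3-cycle through c that avoids a and b is conjugate to (c p q) by an even permutation of the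
   points outside a, b, c, which fixes w. Moving two points this way takes four points, hence seven
   in all. *)
have fixc j k : uniq [:: c; j; k] -> {subset [:: c; j; k] <= S :\: [set a; b]} ->
    w *m rho (cyc3 c j k) = w.
  move=> Uc sc; split_neq Uc.
  have [jD kD] : j \in S :\: [set a; b] /\ k \in S :\: [set a; b].
    by split; apply: sc; rewrite !inE eqxx ?orbT.
  have inDc y : y \in S :\: [set a; b] -> c != y -> y \in S :\: [set a; b; c].
    rewrite !inE !negb_or => /andP[/andP[ya yb] yS] cy.
    by rewrite ya yb yS eq_sym cy.
  have [||||||h [hS [hp hq]]] := @alt_on_trans _ (S :\: [set a; b; c]) [:: p; q] [:: j; k].
  - by rewrite /= !inE; decide_eqs.
  - by rewrite /= !inE; decide_eqs.
  - by [].
  - by move=> y; rewrite !inE => /orP[] /eqP->; rewrite ?pS ?qS; decide_eqs.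
  - move=> y yjk; have /orP[/eqP->|/eqP->] : (y == j) || (y == k) by move: yjk; rewrite !inE.
      exact: inDc.
    exact: inDc.
  - rewrite cardsD /=.
    have : (#|S :&: [set a; b; c]| <= 3)%N.
      apply: leq_trans (subset_leq_card (subsetIr _ _)) _.
      rewrite -[3%N]/(size [:: a; b; c]); apply: leq_trans (card_size _).
      by apply/subset_leq_card/subsetP=> y; rewrite !inE -orbA.
    by move: #|S| #|S :&: _| cS => n m n7 m3; clear -n7 m3; lia.
  have hc : h c = c.
    by case/andP: hS => hS _; apply: out_perm hS _; rewrite !inE eqxx orbT.
  have hS' : alt_on S h by apply: alt_on_sub hS; apply: subsetDl.
  have := alt_repJ rhoP (alt_on_cyc3 Uk sk) hS'.
  rewrite cyc3J hc hp hq => e.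
  have := congr1 (mulmx w) e; rewrite !mulmxA fixk.
  by rewrite fix1.
move=> i j k Uijk sijk.
have rot1 u v t : uniq [:: u; v; t] -> cyc3 u v t = cyc3 v t u.
  by move=> Uv; split_neq Uv; rewrite /cyc3; perm_cases.
have [cin|cnin] := boolP (c \in [:: i; j; k]); last first.
  apply: fix1; apply: alt_on_cyc3 => // y yin; have := sijk y yin.
  rewrite !inE !negb_or => /andP[-> ->]; rewrite !andbT /=.
  by apply: contraNneq cnin => <-.
have Ujki : uniq [:: j; k; i] by move: Uijk; rewrite -(rot_uniq 1%N).
have Ukij : uniq [:: k; i; j] by move: Uijk; rewrite -(rot_uniq 2%N).
move: cin; rewrite !inE => /or3P[] /eqP e.
- by rewrite -e; apply: fixc; rewrite e.
- rewrite rot1 // -e; apply: fixc; rewrite e // => y yin; apply: sijk.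
  by rewrite -(mem_rot 1%N).
- rewrite rot1 // rot1 // -e; apply: fixc; rewrite e // => y yin; apply: sijk.
  by rewrite -(mem_rot 2%N).
Qed.

Lemma standard_bound : (#|S|.-1 <= d)%N.
Proof.
case E: (enum S) => [|a [|b [|c [|p [|q [|r [|s l]]]]]]]; try by move: cS; rewrite cardE E.
have [U sS] := enum_set_uniq (esym E).
have U7 : uniq [:: a; b; c; p; q; r; s].
  by move: U; rewrite -[_ :: _]/([:: a; b; c; p; q; r; s] ++ l) cat_uniq => /andP[].
have s7 : {subset [:: a; b; c; p; q; r; s] <= S}.
  by move=> x xs; apply: sS; rewrite -[_ :: _]/([:: a; b; c; p; q; r; s] ++ l) mem_cat xs.
have [w [w0 wsg wx wfix]] := root_exists U7 s7.
have [aS bS c_S] : [/\ a \in S, b \in S & c \in S].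
  by split; apply: s7; rewrite !inE eqxx ?orbT.
have [pS qS] : p \in S /\ q \in S.
  by split; apply: s7; rewrite !inE eqxx ?orbT.
split_neq U7.
have Ux : uniq [:: a; b; c] by rewrite /= !inE; decide_eqs.
have sx : {subset [:: a; b; c] <= S} by move=> x; rewrite !inE => /or3P[] /eqP->.
have ext3 i j k : uniq [:: i; j; k] -> {subset [:: i; j; k] <= S} ->
    exists g, [/\ alt_on S g, g a = i, g b = j & g c = k].
  move=> Ui si; have [|g [gS [ga gb gc]]] := alt_on_trans Ux Ui (erefl _) sx si.
    by apply: leq_trans cS.
  by exists g.
have ext2 i j : i \in S -> j \in S -> i != j -> exists g, [/\ alt_on S g, g a = i & g b = j].
  move=> iS jS ij; have [k kS] : exists2 k, k \in S & k \notin [:: i; j].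
    by apply: avoid_seq; apply: leq_trans cS.
  rewrite !inE negb_or => /andP[ki kj].
  have [|z|g [gS ga gb _]] := ext3 i j k; last by exists g.
    by rewrite /= !inE; decide_eqs.
  by rewrite !inE => /or3P[] /eqP->.
have wdep g h : alt_on S g -> alt_on S h -> g a = h a -> g b = h b -> w *m rho g = w *m rho h.
  move=> gS hS ea eb; have ghS : alt_on S (g * h^-1)%g by rewrite alt_onM ?alt_onV.
  have fab : alt_on (S :\: [set a; b]) (g * h^-1)%g.
    case/andP: ghS => /subsetP on od; rewrite /alt_on od andbT; apply/subsetP=> x.
    rewrite inE => xg; rewrite inE on ?inE // andbT negb_or.
    apply/andP; split; apply: contraNneq xg => ->; rewrite permM.
      by rewrite ea permK.
    by rewrite eb permK.
  rewrite -{2}(wfix _ fab) -mulmxA -(alt_repM rhoP) // mulgKV //.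
(* The vector w is transported by any even permutation taking (a, b) to (i, j); by [wdep] the choice
   does not matter, since w is fixed by the stabiliser of a and b. The default 0 is never met for
   distinct i, j in [S]. *)
pose W i j := if [pick g | [&& alt_on S g, g a == i & g b == j]] is Some g
  then w *m rho g else 0.
have WE g : alt_on S g -> W (g a) (g b) = w *m rho g.
  move=> gS; rewrite /W; case: pickP => [h /and3P[hS /eqP ha /eqP hb]|/(_ g)]; first exact: wdep.
  by rewrite gS !eqxx.
have sgS : alt_on S (dtr a b p q) by apply: mem_alt_on_dtr.
have xS : alt_on S (cyc3 a b c) := alt_on_cyc3 Ux sx.
apply: (@root_bound _ _ _ _ rho W) => // [h i j hS iS jS ij|i j iS jS ij|i j k iS jS kS ij jk ki|i j iS jS ij].
- have [g [gS <- <-]] := ext2 i j iS jS ij.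
  by rewrite WE // -mulmxA -(alt_repM rhoP) // -!permM WE ?alt_onM.
- have [g [gS <- <-]] := ext2 i j iS jS ij.
  rewrite WE // -mulNmx -wsg -mulmxA -(alt_repM rhoP) // -(WE _ (alt_onM sgS gS)) !(permM _ g).
  have -> : dtr a b p q a = b by rewrite /dtr; perm_eval.
  by have -> : dtr a b p q b = a by rewrite /dtr; perm_eval.
- have [|z|g [gS <- <- <-]] := ext3 i j k.
  + by rewrite /= !inE; decide_eqs.
  + by rewrite !inE => /or3P[] /eqP->.
  have xa : cyc3 a b c a = b by rewrite /cyc3; perm_eval.
  have xb : cyc3 a b c b = c by rewrite /cyc3; perm_eval.
  have xc : cyc3 a b c c = a by rewrite /cyc3; perm_eval.
  have e1 : W (g b) (g c) = w *m rho (cyc3 a b c) *m rho g.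
    by rewrite -mulmxA -(alt_repM rhoP) // -(WE _ (alt_onM xS gS)) !(permM _ g) xa xb.
  have xxS : alt_on S (cyc3 a b c * cyc3 a b c)%g by apply: alt_onM.
  have e2 : W (g c) (g a) = w *m rho (cyc3 a b c * cyc3 a b c)%g *m rho g.
    rewrite -mulmxA -(alt_repM rhoP) // -(WE _ (alt_onM xxS gS)).
    by rewrite !(permM _ g) !(permM (cyc3 a b c) (cyc3 a b c)) xa xb xc.
  by rewrite WE // e1 e2 -!mulmxDl wx mul0mx.
- have [g [gS <- <-]] := ext2 i j iS jS ij.
  rewrite WE //; apply: contraNneq w0 => e.
  by apply/eqP/(alt_rep_inj rhoP gS); rewrite e mul0mx.
Qed.

End StandardCase.

Theorem alt_rep_bound (T : finType) (F : fieldType) (w : F) :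
    (forall n, n.+1%:R != 0 :> F) -> prim3 w ->
    cyclotomic_bound F 5 -> cyclotomic_bound F 7 ->
  forall (S : {set T}) d (rho : {perm T} -> 'M[F]_d), (5 <= #|S|)%N ->
    alt_rep S rho -> rep_nontriv S rho -> (#|S|.-1 <= d)%N.
Proof.
move=> F_char0 pw b5 b7 S; have [m] := ubnP #|S|; elim: m S => // m IHm S; rewrite ltnS => Sm.
move=> d rho S5 rhoP nt.
(* From 8 points on, removing a 3-cycle leaves at least five points, the range of the induction
   hypothesis, and 2(n - 4) >= n - 1. *)
have [S8|] := leqP 8 #|S|; last first.
  move: (S5); rewrite leq_eqVlt => /orP[/eqP e _|]; first by rewrite -e (alt5_rep_bound rhoP).
  rewrite leq_eqVlt => /orP[/eqP e _|]; first by rewrite -e (alt6_rep_bound F_char0 rhoP pw).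
  rewrite leq_eqVlt => /orP[/eqP e _|]; first by rewrite -e (alt7_rep_bound rhoP).
  by move=> h1 h2; have := leq_trans h2 h1; rewrite ltnn.
pose bad (t : T * T * T * (T * T * T)) :=
  let: ((a, b, c), (p, q, r)) := t in
  [&& uniq [:: a; b; c; p; q; r], all (mem S) [:: a; b; c; p; q; r] &
    (rho (cyc3 a b c) - 1%:M) *m (rho (cyc3 p q r) - 1%:M) != 0].
have [/existsP[[[[a b] c] [[p q] r]] /and3P[U /allP sS XY]]|/existsPn good] :=
  boolP [exists t, bad t]; last first.
  apply: (standard_bound F_char0 rhoP) => //; first exact: leq_trans S8.
  move=> a b c p q r U sS; apply/eqP; have := good ((a, b, c), (p, q, r)).
  have sS' : all (mem S) [:: a; b; c; p; q; r] by apply/allP.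
  by rewrite /bad U sS' !andTb negbK.
have cS' : #|S :\: [set a; b; c]| = (#|S| - 3)%N.
  rewrite cardsDS.
    congr (_ - _)%N; split_neq U.
    by rewrite -setUA !cardsU1 cards1 !inE; decide_eqs.
  by apply/subsetP=> x; rewrite !inE -orbA => /or3P[] /eqP->; apply: sS; rewrite !inE eqxx ?orbT.
have := disjoint_step F_char0 rhoP pw U sS XY (m := (#|S| - 4)%N).
have arith n : (8 <= n)%N -> (n.-1 <= n - 4 + (n - 4))%N by lia.
move=> h; apply: leq_trans (arith _ S8) (h _) => d' rho' rhoP' nt'.
have -> : (#|S| - 4)%N = #|S :\: [set a; b; c]|.-1 by rewrite cS'; lia.
apply: IHm rhoP' nt'; rewrite cS'; last by move: S8; clear; lia.
by move: Sm S8; clear; lia.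
Qed.

(** * Rational representations *)

Lemma eigenvalue_of_factors (F : fieldType) d (A : 'M[F]_d.+1) (s : seq F) (v : 'rV_d.+1) :
  v != 0 -> v *m horner_mx A (\prod_(c <- s) ('X - c%:P)) = 0 ->
  exists2 c, c \in s & eigenvalue A c.
Proof.
elim: s v => [|c s IHs] v v0; first by rewrite big_nil rmorph1 mulmx1 => e; rewrite e eqxx in v0.
rewrite big_cons rmorphM /= -[_ * _]/(_ *m _) mulmxA.
have [vc0 _|vc0 /(IHs _ vc0)[c' c's ec']] := eqVneq (v *m horner_mx A ('X - c%:P)) 0.
  exists c; first exact: mem_head.
  apply/eigenvalueP; exists v => //.
  move: vc0; rewrite rmorphB /= horner_mx_X horner_mx_C mulmxBr mul_mx_scalar.
  by move/eqP; rewrite subr_eq0 => /eqP.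
by exists c'; rewrite // inE c's orbT.
Qed.

(** The assumption says that the primitive p-th roots of unity are conjugate over F. A vector v in
    the image of M - 1 is killed by the product of the M - z^i for 0 < i < p, so some primitive root
    is an eigenvalue; the characteristic polynomial has coefficients in F and thus all p - 1 of them
    as roots. *)
Lemma cyclotomic_bound_gal (F : fieldType) (j : {rmorphism F -> algC}) p : prime p ->
    (forall k, coprime k p -> exists u : {rmorphism algC -> algC},
       (forall a, u (j a) = j a) /\ forall z, z ^+ p = 1 -> u z = z ^+ k) ->
  cyclotomic_bound F p.
Proof.
move=> pp gal [|d] M Mp M1; first by case/eqP: M1; apply/matrixP=> -[].
have [z zP] := C_prim_root_exists (prime_gt0 pp).
pose A := map_mx j M.
have Ap : A ^+ p = 1 by rewrite -[A ^+ p](rmorphXn (map_mx j)) Mp rmorph1.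
have A1 : A - 1 != 0.
  by rewrite subr_eq0 -(rmorph1 (map_mx j)); apply: contra_neq M1 => /map_mx_inj.
have /rowV0Pn[v /submxP[v0 ev] vn] := A1.
have [_ /mapP[i + ->] Ai] : exists2 c, c \in [seq z ^+ i | i <- index_iota 1 p] & eigenvalue A c.
  apply: (@eigenvalue_of_factors _ _ A _ v) => //.
  rewrite big_map ev -mulmxA.
  have -> : A - 1 = horner_mx A ('X - (z ^+ 0)%:P).
    by rewrite rmorphB /= horner_mx_X horner_mx_C expr0.
  rewrite -[horner_mx A _ *m _]/(_ * _) -rmorphM /=.
  have := factor_Xn_sub_1 zP; rewrite big_ltn ?prime_gt0 // => ->.
  by rewrite rmorphB /= rmorphXn /= horner_mx_X rmorph1 Ap subrr mulmx0.
rewrite mem_index_iota => /andP[i0 ip].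
have zi : p.-primitive_root (z ^+ i).
  by rewrite prim_root_exp_coprime // coprime_sym prime_coprime // gtnNdvd.
have cA : char_poly A = map_poly j (char_poly M) by rewrite map_char_poly.
rewrite eigenvalue_root_char cA in Ai.
have -> : p.-1 = size [seq (z ^+ i) ^+ k | k <- index_iota 1 p] by rewrite size_map size_iota subn1.
rewrite -ltnS -(size_char_poly A); apply: max_poly_roots.
- by rewrite monic_neq0 // char_poly_monic.
- apply/allP=> _ /mapP[k + ->]; rewrite mem_index_iota => /andP[k0 kp].
  have [|u [uj uz]] := gal k; first by rewrite coprime_sym prime_coprime // gtnNdvd.
  rewrite -(uz _ (prim_expr_order zi)) cA.
  have -> : map_poly j (char_poly M) = map_poly u (map_poly j (char_poly M)).
    by rewrite -map_poly_comp; apply: eq_map_poly => a /=; rewrite uj.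
  by rewrite fmorph_root.
- rewrite map_inj_in_uniq ?iota_uniq // => k l; rewrite !mem_index_iota => /andP[_ kp] /andP[_ lp].
  by move/eqP; rewrite (eq_prim_root_expr zi) !modn_small // => /eqP.
Qed.

Lemma cyclotomic_bound_rat p : prime p -> cyclotomic_bound rat p.
Proof.
move=> pp; apply: (@cyclotomic_bound_gal _ (@ratr algC)) => // k kp.
have [u uz] := Qn_aut_exists kp.
by exists u; split=> // a; apply: fmorph_rat.
Qed.

(** The field is Q(omega). For p other than 3, the Chinese remainder theorem gives an exponent that
    is k modulo p and 1 modulo 3, hence an automorphism fixing omega with prescribed action on p-th
    roots of unity. *)
Lemma prim3_field_exists : exists (F : fieldExtType rat) (w : F),
  prim3 w /\ forall p, prime p -> p != 3 -> cyclotomic_bound F p.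
Proof.
have [z zP] := C_prim_root_exists (isT : (0 < 3)%N).
have [F [j [[|w []] //= [jw] full]]] := num_field_exists [:: z].
have z1 : z - 1 != 0.
  rewrite subr_eq0; have := eq_prim_root_expr zP 1 0.
  by rewrite expr1 expr0 => ->.
have pz : prim3 z.
  apply/eqP; rewrite -(inj_eq (mulfI z1)) mulr0; apply/eqP.
  transitivity (z ^+ 3 - 1); first by ring.
  by rewrite prim_expr_order // subrr.
exists F, w; split.
  by apply: (fmorph_inj j); rewrite !rmorphD rmorphXn rmorph1 rmorph0 /= jw.
move=> p pp p3; apply: (cyclotomic_bound_gal (j := j)) => // k kp.
have p3c : coprime p 3 by rewrite prime_coprime // dvdn_prime2.
have cop : coprime (chinese p 3 k 1) (p * 3).
  rewrite coprimeMr -coprime_modl chinese_modl // coprime_modl kp.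
  by rewrite -coprime_modl chinese_modr.
have [u uz] := Qn_aut_exists cop; exists u; split; last first.
  move=> y yp; rewrite uz; last by rewrite exprM yp expr1n.
  by rewrite -(expr_mod _ yp) chinese_modl // expr_mod.
have uw : u (j w) = j w.
  have z3 := prim_expr_order zP.
  rewrite jw uz; last by rewrite mulnC exprM z3 expr1n.
  by rewrite -(expr_mod _ z3) chinese_modr.
move=> a; have : a \in <<1; w>>%VS by rewrite -adjoin_seq1 full memvf.
case/Fadjoin_polyP=> q /polyOverP q1 ->.
rewrite -(horner_map j) -(horner_map u) /= uw; congr (_.[_]).
rewrite -map_poly_comp; apply/polyP=> i; rewrite !coef_map_id0 ?rmorph0 //=.
by have /vlineP[x ->] := q1 i; rewrite alg_num_field !fmorph_rat.
Qed.

(** Some 3-cycle acts nontrivially, since 3-cycles generate; over the rationals it forces dimension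
    2. Only the second bound passes through Q(omega). *)
Theorem rat_alt_rep_bound (T : finType) (S : {set T}) d (rho : {perm T} -> 'M[rat]_d) :
    alt_rep S rho -> rep_nontriv S rho ->
  (2 <= d)%N /\ ((5 <= #|S|)%N -> (#|S|.-1 <= d)%N).
Proof.
move=> rhoP nt; split.
  pose bad (t : T * T * T) := let: (a, b, c) := t in
    [&& uniq [:: a; b; c], all (mem S) [:: a; b; c] & rho (cyc3 a b c) != 1%:M].
  have [/existsP[[[a b] c] /and3P[U /allP sS abc1]]|/existsPn good] := boolP [exists t, bad t].
    apply: (cyclotomic_bound_rat (isT : prime 3) _ abc1).
    rewrite -(alt_repX rhoP) ?alt_on_cyc3 // !expgS expg0 mulg1 mulgA cyc3_cube //.
    exact: alt_rep1 rhoP.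
  case: nt => g gS /eqP[]; rewrite -[LHS]mul1mx.
  apply: (fix_cyc3_fix rhoP (subxx S)) gS => a b c U sS; rewrite mul1mx.
  have sS' : all (mem S) [:: a; b; c] by apply/allP.
  by have := good (a, b, c); rewrite /bad U sS' !andTb negbK => /eqP.
move=> cS; have [F [w [pw cyc]]] := prim3_field_exists.
apply: (@alt_rep_bound _ F w _ pw (cyc 5 isT isT) (cyc 7 isT isT) S d
  (fun g => map_mx (in_alg F) (rho g))) => //.
- by move=> n; rewrite -(rmorph_nat (in_alg F)) fmorph_eq0 Num.Theory.pnatr_eq0.
- case: rhoP => r1 rM; split; first by rewrite r1 map_mx1.
  by move=> g h gS hS; rewrite rM // map_mxM.
- case: nt => g gS g1; exists g => //; apply: contra_neq g1 => e.
  by apply: (@map_mx_inj _ _ (in_alg F)); rewrite e map_mx1.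
Qed.

(* Averaging splits off the fixed vectors, leaving a representation of
   dimension at most d - k on which the group still acts nontrivially. *)
Lemma rat_fixed_bound (T : finType) (S : {set T}) d (rho : {perm T} -> 'M[rat]_d) k
    (U : 'M_(k, d)) : alt_rep S rho -> rep_nontriv S rho -> row_free U ->
    (forall g, alt_on S g -> U *m rho g = U) ->
  (k + 2 <= d)%N /\ ((5 <= #|S|)%N -> (k + #|S|.-1 <= d)%N).
Proof.
move=> rhoP nt Ufree Ufix.
pose N := #|[pred g | alt_on S g]|; have N0 : N%:R != 0 :> rat.
  rewrite Num.Theory.pnatr_eq0 -lt0n; apply/card_gt0P; exists 1%g.
  by rewrite inE alt_on1.
pose E := N%:R^-1 *: \sum_(g | alt_on S g) rho g.
have Erho h : alt_on S h -> E *m rho h = E.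
  move=> hS; rewrite /E -scalemxAl mulmx_suml; congr (_ *: _).
  rewrite [RHS](reindex_inj (mulIg h)) /=; apply: eq_big => g.
    apply/idP/idP=> [gS|ghS]; first exact: alt_onM.
    by rewrite -[g](mulgK h) alt_onM // alt_onV.
  by move=> gS; rewrite (alt_repM rhoP).
have rhoE h : alt_on S h -> rho h *m E = E.
  move=> hS; rewrite /E -scalemxAr mulmx_sumr; congr (_ *: _).
  rewrite [RHS](reindex_inj (mulgI h)) /=; apply: eq_big => g.
    apply/idP/idP=> [gS|hgS]; first exact: alt_onM.
    by rewrite -[g](mulKg h) alt_onM // alt_onV.
  by move=> gS; rewrite (alt_repM rhoP).
have avg k' (v : 'M_(k', d)) : (forall g, alt_on S g -> v *m rho g = v) -> v *m E = v.
  move=> vfix; rewrite -scalemxAr mulmx_sumr (eq_bigr (fun=> v)) //.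
  by rewrite sumr_const -scaler_nat scalerA mulVf ?scale1r.
have EE : E *m E = E by apply: avg => g; apply: Erho.
pose W := 1%:M - E.
have Wrho g : alt_on S g -> W *m rho g = rho g *m W.
  by move=> gS; rewrite mulmxBl mulmxBr mul1mx mulmx1 Erho ?rhoE.
have Wst g : alt_on S g -> (W *m rho g <= W)%MS by move=> gS; rewrite Wrho ?submxMl.
have UW0 : (U :&: W = 0)%MS.
  apply/eqP; rewrite -submx0; apply/rV_subP=> v; rewrite sub_capmx.
  case/andP=> /submxP[u e] /submxP[u' e']; rewrite submx0; apply/eqP.
  have <- : v *m E = v by rewrite e -mulmxA avg.
  by rewrite e' -mulmxA mulmxBl mul1mx EE subrr mulmx0.
have [rho' [rhoP' tr]] := subrep_exists rhoP Wst.
(* If [g] were trivial on the image of 1 - E, then rho g - E = 1 - E. *)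
have nt' : rep_nontriv S rho'.
  case: nt => g gS g1; exists g => //; apply: contra_neq g1 => /(tr g gS).
  by rewrite mulmxBl mul1mx Erho // => /addIr.
have kd : (k + \rank W <= d)%N.
  have /eqP {1}<- := Ufree.
  by rewrite -(mxrank_disjoint_sum UW0) rank_leq_col.
have [b2 b5] := rat_alt_rep_bound rhoP' nt'.
split=> [|cS]; apply: leq_trans kd; rewrite leq_add2l //.
exact: b5.
Qed.

(** * Rank of the invariants *)

Section AdditiveOn.
Variables (V W : zmodType) (S : V -> Prop) (f : V -> W).
Hypotheses (S0 : S 0) (SB : forall x y, S x -> S y -> S (x - y)).
Hypothesis fB : forall x y, S x -> S y -> f (x - y) = f x - f y.

Lemma subgN x : S x -> S (- x).
Proof. by move=> Sx; rewrite -sub0r; apply: SB. Qed.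

Lemma subgD x y : S x -> S y -> S (x + y).
Proof. by move=> Sx Sy; rewrite -[y]opprK; apply/SB/subgN. Qed.

Lemma subgMz x c : S x -> S (x *~ c).
Proof.
move=> Sx; have Sn n : S (x *+ n).
  by elim: n => [|n IHn]; rewrite ?mulr0n // mulrS; apply: subgD.
by case: c => n; [apply: Sn | apply/subgN/Sn].
Qed.

Lemma subg_sum (I : Type) (r : seq I) (P : pred I) (F : I -> V) :
  (forall i, P i -> S (F i)) -> S (\sum_(i <- r | P i) F i).
Proof. by move=> SF; elim/big_ind: _ => //; apply: subgD. Qed.

Lemma add_on0 : f 0 = 0.
Proof. by rewrite -[0 in LHS](subrr 0) fB // subrr. Qed.

Lemma add_onN x : S x -> f (- x) = - f x.
Proof. by move=> Sx; rewrite -sub0r fB // add_on0 sub0r. Qed.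

Lemma add_onD x y : S x -> S y -> f (x + y) = f x + f y.
Proof.
by move=> Sx Sy; rewrite -[y in LHS]opprK fB ?add_onN ?opprK //; apply: subgN.
Qed.

Lemma add_onMz x c : S x -> f (x *~ c) = f x *~ c.
Proof.
move=> Sx; have Sn n : S (x *+ n) by apply: (@subgMz x n).
have fn n : f (x *+ n) = f x *+ n.
  elim: n => [|n IHn]; first by rewrite !mulr0n add_on0.
  by rewrite !mulrS add_onD ?IHn.
case: c => n; first exact: fn.
by rewrite NegzE !mulrNz -!pmulrn add_onN // fn.
Qed.

Lemma add_on_sum (I : Type) (r : seq I) (P : pred I) (F : I -> V) :
  (forall i, P i -> S (F i)) ->
  f (\sum_(i <- r | P i) F i) = \sum_(i <- r | P i) f (F i).
Proof.
move=> SF; suff [] : f (\sum_(i <- r | P i) F i) = \sum_(i <- r | P i) f (F i)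
  /\ S (\sum_(i <- r | P i) F i) by [].
elim: r => [|i r [IH1 IH2]]; first by rewrite !big_nil add_on0.
rewrite !big_cons; case: ifP => // Pi.
by rewrite add_onD ?IH1 //; [split=> //; apply: subgD; first exact: SF | apply: SF].
Qed.

End AdditiveOn.

Lemma clear_denominators (k : nat) (c : 'I_k -> rat) :
  exists M : int, M != 0 /\ exists c' : 'I_k -> int, forall i, c i * M%:~R = (c' i)%:~R.
Proof.
exists (\prod_i denq (c i)); split.
  by apply/prodf_neq0 => i _; apply: denq_neq0.
exists (fun i => numq (c i) * \prod_(l | l != i) denq (c l)) => i.
rewrite (bigD1 i) //= !rmorphM /= mulrA; congr (_ * _).
by rewrite -{1}(divq_num_den (c i)) divfK // intr_eq0 denq_neq0.
Qed.

Lemma has_indep_family_sub (V : zmodType) (S S' : V -> Prop) r :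
  (forall x, S x -> S' x) -> has_indep_family S r -> has_indep_family S' r.
Proof. by move=> sub [x [xS ind]]; exists x; split=> // i; apply/sub/xS. Qed.

Section RankOfFixedPart.
Variables (T : finType) (D : {set T}) (V : zmodType) (S : V -> Prop).
Variable act : {perm T} -> V -> V.
Hypotheses (S0 : S 0) (SB : forall x y, S x -> S y -> S (x - y)).
Hypothesis actS : forall g x, alt_on D g -> S x -> S (act g x).
Hypothesis actB : forall g x y, alt_on D g -> S x -> S y ->
  act g (x - y) = act g x - act g y.
Hypothesis act1 : forall x, S x -> act 1%g x = x.
Hypothesis actM : forall g h x, alt_on D g -> alt_on D h -> S x ->
  act (g * h)%g x = act h (act g x).

Definition fixed_part (x : V) : Prop :=
  S x /\ forall g, alt_on D g -> act g x = x.

Lemma fixed_part_norm x : S x -> fixed_part (\sum_(g | alt_on D g) act g x).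
Proof.
move=> Sx; split=> [|h hD]; first by apply: subg_sum => // g gD; apply: actS.
rewrite (add_on_sum S0 SB (fun y z => @actB h y z hD)) => [|g gD]; last exact: actS.
rewrite [RHS](reindex_inj (mulIg h)) /=; apply: eq_big => g.
  apply/idP/idP=> [gS|ghS]; first exact: alt_onM.
  by rewrite -[g](mulgK h) alt_onM // alt_onV.
by move=> gD; rewrite actM.
Qed.

Section Coordinates.
Variables (s : nat) (x : 'I_s -> V).
Hypothesis xS : forall i, S (x i).
Hypothesis x_indep : forall c : 'I_s -> int, \sum_i x i *~ c i = 0 -> forall i, c i = 0.
Hypothesis s_max : ~ has_indep_family S s.+1.

(** The image of y in V (x) Q in the basis x, expressed by an integral relation N y = sum c_i x_i
    with q_i = c_i / N. *)
Definition is_coord (y : V) (q : 'rV[rat]_s) : Prop :=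
  exists (N : int) (c : 'I_s -> int),
    [/\ N != 0, y *~ N = \sum_i x i *~ c i & forall i, q 0 i * N%:~R = (c i)%:~R].

(** By maximality the family x with y appended is dependent, and y occurs in the relation because x
    is independent. *)
Lemma is_coord_exists y : S y -> exists q, is_coord y q.
Proof.
move=> Sy; pose z (i : 'I_s.+1) := if unlift ord_max i is Some l then x l else y.
have zS i : S (z i) by rewrite /z; case: unlift.
have [c [cz [i0 ci0]]] : exists c : 'I_s.+1 -> int,
    \sum_i z i *~ c i = 0 /\ exists i, c i != 0.
  apply: contrapT => none; apply: s_max; exists z; split=> // c cz i.
  by apply/eqP; apply: contrapT => ci; apply: none; exists c; split=> //; exists i; apply/negP.
have zl l : z (lift ord_max l) = x l by rewrite /z liftK.
have zm : z ord_max = y by rewrite /z unlift_none.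
have e : \sum_i x i *~ c (lift ord_max i) + y *~ c ord_max = 0.
  rewrite -[RHS]cz (bigD1_ord ord_max) //= zm [RHS]addrC; congr (_ + _).
  by apply: eq_bigr => i _; rewrite zl.
have cm0 : c ord_max != 0.
  apply/eqP=> cm0; move: e; rewrite cm0 mulr0z addr0 => /x_indep cl.
  by case: (unliftP ord_max i0) ci0 => [l ->|->]; rewrite ?cl ?cm0 eqxx.
exists (\row_i ((- c (lift ord_max i))%:~R / (c ord_max)%:~R)).
exists (c ord_max), (fun i => - c (lift ord_max i)); split=> // [|i].
  move/eqP: e; rewrite addrC addr_eq0 => /eqP->; rewrite -sumrN.
  by apply: eq_bigr => i _; rewrite mulrNz.
by rewrite mxE divfK // intr_eq0.
Qed.

Lemma is_coord_uniq y q q' : is_coord y q -> is_coord y q' -> q = q'.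
Proof.
case=> N [c [N0 yc qc]] [N' [c' [N0' yc' qc']]]; apply/rowP=> i.
have e : \sum_i x i *~ (c i * N' - c' i * N) = 0.
  transitivity (y *~ N *~ N' - y *~ N' *~ N); last by rewrite -!mulrzA mulrC subrr.
  rewrite yc yc' !mulrz_suml -sumrB; apply: eq_bigr => l _.
  by rewrite mulrzBr -!mulrzA.
have /eqP := x_indep e i; rewrite subr_eq0 => /eqP {}e.
apply: (mulIf (x := (N * N')%:~R)); first by rewrite intr_eq0 mulf_neq0.
transitivity ((c i * N')%:~R : rat); first by rewrite !rmorphM /= -qc mulrA.
by rewrite e !rmorphM /= -qc'; ring.
Qed.

Lemma is_coordB y y' q q' : is_coord y q -> is_coord y' q' -> is_coord (y - y') (q - q').
Proof.
case=> N [c [N0 yc qc]] [N' [c' [N0' yc' qc']]].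
exists (N * N'), (fun i => c i * N' - c' i * N); split=> [||i].
- by rewrite mulf_neq0.
- rewrite mulrzBl [in X in _ - X]mulrC !mulrzA yc yc' !mulrz_suml -sumrB.
  by apply: eq_bigr => l _; rewrite mulrzBr -!mulrzA.
- by rewrite !mxE rmorphB !rmorphM /= -qc -qc'; ring.
Qed.

Lemma is_coord_basis i : is_coord (x i) (delta_mx 0 i).
Proof.
exists 1, (fun l => (l == i)%:R); split=> // [|l]; last by rewrite mulr1 mxE eqxx /=; case: (l == i).
rewrite (bigD1 i) //= eqxx big1 ?addr0 // => l /negbTE->.
by rewrite mulr0z.
Qed.

Lemma is_coord_torsion y : is_coord y 0 -> exists2 N : int, N != 0 & y *~ N = 0.
Proof.
case=> N [c [N0 yc qc]]; exists N => //; rewrite yc big1 // => i _.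
by have /esym/eqP := qc i; rewrite mxE mul0r intr_eq0 => /eqP->; rewrite mulr0z.
Qed.

End Coordinates.

(** In the coordinates [kap], whose kernel is torsion, the action becomes a rational representation
    [rho]. If it is nontrivial, [rat_fixed_bound] applies to the coordinates of a maximal family of
    fixed elements. If it is trivial, the norms of the x_i are, up to torsion, multiples of the x_i,
    so the two ranks agree. *)
Theorem fixed_rank_gap s r : is_rank S s -> is_rank fixed_part r ->
  s = r \/ (r + 2 <= s)%N /\ ((5 <= #|D|)%N -> (r + #|D|.-1 <= s)%N).
Proof.
move=> [[x [xS x_indep]] smax] [[y [yF y_indep]] rmax].
have nS1 : ~ has_indep_family S s.+1 by move=> /smax; rewrite ltnn.
have /choice[kap kapP] : forall z, exists q, S z -> is_coord x z q.
  move=> z.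
  have [Sz|nSz] := pselect (S z); last by exists 0.
  by have [q qP] := is_coord_exists xS x_indep nS1 Sz; exists q.
have kapB u v : S u -> S v -> kap (u - v) = kap u - kap v.
  move=> Su Sv; apply: (is_coord_uniq x_indep); first by apply/kapP/SB.
  by apply: is_coordB; apply: kapP.
have kapx i : kap (x i) = delta_mx 0 i.
  by apply: (is_coord_uniq x_indep); [apply: kapP | apply: is_coord_basis].
have kapMz := add_onMz S0 SB kapB.
have kapS := add_on_sum S0 SB kapB.
pose rho g : 'M[rat]_s := \matrix_i kap (act g (x i)).
have kap_act g z : alt_on D g -> S z -> kap (act g z) = kap z *m rho g.
  move=> gD Sz; have [N [c [N0 zc qc]]] := kapP z Sz.
  have N0' : N%:~R != 0 :> rat by rewrite intr_eq0.
  have actMz := add_onMz S0 SB (fun u v => @actB g u v gD).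
  apply: (scalerI N0'); rewrite scaler_int -(kapMz _ _ (actS gD Sz)) -(actMz _ _ Sz) zc.
  rewrite (add_on_sum S0 SB (fun u v => @actB g u v gD)); last by move=> i _; apply: subgMz.
  rewrite kapS; last by move=> i _; apply: actS => //; apply: subgMz.
  rewrite scalemxAl mulmx_sum_row; apply: eq_bigr => i _.
  rewrite (actMz _ _ (xS i)) (kapMz _ _ (actS gD (xS i))) rowK -scaler_int; congr (_ *: _).
  by rewrite mxE mulrC qc.
have rhoP : alt_rep D rho.
  split=> [|g h gD hD]; apply/row_matrixP=> i.
    by rewrite rowK (act1 (xS i)) kapx rowE mulmx1.
  by rewrite row_mul !rowK (actM gD hD (xS i)) (kap_act _ _ hD (actS gD (xS i))).
have [/existsP[g0 /andP[g0D g01]]|/existsPn triv] :=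
  boolP [exists g, alt_on D g && (rho g != 1%:M)].
  right; have nt : rep_nontriv D rho by exists g0.
  pose U := \matrix_(i < r) kap (y i).
  apply: (rat_fixed_bound (U := U) rhoP nt) => [|g gD]; last first.
    apply/row_matrixP=> i; have [Sy fixy] := yF i.
    by rewrite row_mul !rowK -(kap_act _ _ gD Sy) fixy.
  (* A rational relation among the coordinates of the y_i, cleared of denominators, makes an
     integral combination of the y_i torsion, against their independence. *)
  rewrite -kermx_eq0; apply/rowV0P=> c /sub_kermxP cU.
  have [M [M0 [c' c'P]]] := clear_denominators (c 0).
  have yS i : S (y i) by case: (yF i).
  have M0' : M%:~R != 0 :> rat by rewrite intr_eq0.
  have ky : kap (\sum_i y i *~ c' i) = 0.
    rewrite kapS; last by move=> i _; apply: subgMz.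
    transitivity (M%:~R *: (c *m U)); last by rewrite cU scaler0.
    rewrite mulmx_sum_row scaler_sumr; apply: eq_bigr => i _.
    by rewrite (kapMz _ _ (yS i)) rowK scalerA mulrC c'P scaler_int.
  have Sy : S (\sum_i y i *~ c' i) by apply: subg_sum => // i _; apply: subgMz.
  have := kapP _ Sy; rewrite ky => /is_coord_torsion[N N0 yN].
  have c'0 i : c' i = 0.
    have /y_indep/(_ i)/eqP : \sum_i y i *~ (c' i * N) = 0.
      by rewrite -[RHS]yN mulrz_suml; apply: eq_bigr => l _; rewrite mulrzA.
    by rewrite mulf_eq0 (negbTE N0) orbF => /eqP.
  apply/rowP=> i; rewrite mxE; apply: (mulIf M0').
  by rewrite c'P c'0 mul0r.
left; apply/eqP; rewrite eqn_leq; apply/andP; split; last first.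
  by apply: smax; apply: (has_indep_family_sub (S := fixed_part)); [move=> z [] | exists y].
apply: rmax; exists (fun i => \sum_(g | alt_on D g) act g (x i)); split.
  by move=> i; apply: fixed_part_norm.
move=> c e i; pose N := #|[pred g | alt_on D g]|.
have N0 : N%:R != 0 :> rat.
  rewrite Num.Theory.pnatr_eq0 -lt0n; apply/card_gt0P; exists 1%g.
  by rewrite inE alt_on1.
have kN l : kap (\sum_(g | alt_on D g) act g (x l)) = N%:R *: delta_mx 0 l.
  rewrite kapS => [|g gD]; last exact: actS.
  rewrite (eq_bigr (fun=> delta_mx 0 l)) => [|g gD]; first by rewrite sumr_const scaler_nat.
  rewrite (kap_act _ _ gD (xS l)) kapx; have := triv g; rewrite gD negbK => /eqP->.
  by rewrite mulmx1.
have Sn l : S (\sum_(g | alt_on D g) act g (x l)) by case: (fixed_part_norm (xS l)).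
have := congr1 kap e; rewrite (add_on0 S0 kapB) kapS; last by move=> l _; apply: subgMz.
move/rowP/(_ i); rewrite summxE (bigD1 i) //= [X in _ + X]big1 => [|l li]; last first.
  by rewrite (kapMz _ _ (Sn l)) kN -scaler_int !mxE eqxx /= eq_sym (negbTE li) !mulr0.
rewrite addr0 (kapMz _ _ (Sn i)) kN -scaler_int !mxE !eqxx mulr1 => /eqP.
by rewrite mulf_eq0 (negbTE N0) orbF intr_eq0 => /eqP.
Qed.

End RankOfFixedPart.

(** * The Galois action on rational points *)

Section Projective.
Variables (F : fieldType) (n : nat).
Implicit Types (P Q : proj_space F n) (u v : 'rV[F]_n.+1).

Lemma hcoords_line P v : hcoords P v -> val P = <[v]>%VS.
Proof.
case/andP=> v0 vP; apply/eqP; rewrite eq_sym eqEdim -memvE vP dim_vline v0.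
by rewrite (eqP (valP P)).
Qed.

Lemma hcoords_scale P u v : hcoords P u -> hcoords P v ->
  exists2 c, c != 0 & v = c *: u.
Proof.
move=> Pu Pv; have /andP[v0] := Pv; rewrite (hcoords_line Pu) => /vlineP[c e].
by exists c; rewrite // ; apply: contraNneq v0 => c0; rewrite e c0 scale0r.
Qed.

Lemma hcoordsZ P u c : c != 0 -> hcoords P u -> hcoords P (c *: u).
Proof. by move=> c0 /andP[u0 uP]; rewrite /hcoords scaler_eq0 negb_or c0 u0 memvZ. Qed.

Lemma hcoords_inj P Q v : hcoords P v -> hcoords Q v -> P = Q.
Proof. by move=> /hcoords_line Pv /hcoords_line Qv; apply: val_inj; rewrite Pv Qv. Qed.

Lemma hcoords_exists v : v != 0 -> exists P, hcoords P v.
Proof.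
move=> v0; have dv : \dim <[v]>%VS == 1%N by rewrite dim_vline v0.
exists (exist (fun U : {vspace 'rV[F]_n.+1} => \dim U == 1%N) _ dv).
by rewrite /hcoords v0 /= memv_line.
Qed.

End Projective.

Lemma meval_map_mpoly (R S : comNzRingType) (h : {rmorphism R -> S}) n
    (f : {mpoly R[n]}) (x : 'I_n -> S) :
  (map_mpoly h f).@[x] = \sum_(m <- msupp f) h f@_m * \prod_i x i ^+ m i.
Proof.
rewrite /map_mpoly /mmap raddf_sum; apply: eq_bigr => m _ /=.
rewrite mevalM mevalC; congr (_ * _).
by rewrite rmorph_prod; apply: eq_bigr => i _ /=; rewrite rmorphXn /= mevalXU.
Qed.

Lemma homog_scale (F : fieldType) n d (f : {mpoly F[n]}) (c : F) (v : 'rV[F]_n) :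
  f \is d.-homog -> f.@[(c *: v) 0] = c ^+ d * f.@[v 0].
Proof.
move=> fd; rewrite !mevalE mulr_sumr !big_seq; apply: eq_bigr => m mf.
rewrite mulrCA; congr (_ * _).
rewrite -(dhomog_mf fd mf) /= mdegE -prodrXr -big_split /=.
by apply: eq_bigr => i _; rewrite mxE exprMn.
Qed.

Lemma map_mpoly_homog (R S : comNzRingType) (h : {rmorphism R -> S}) n d
    (f : {mpoly R[n]}) : f \is d.-homog -> map_mpoly h f \is d.-homog.
Proof.
move=> fd; apply/dhomogP => m; rewrite mcoeff_msupp mcoeff_map_mpoly => hm.
apply: (dhomog_mf fd); rewrite mcoeff_msupp; apply: contra_neq hm => ->.
exact: rmorph0.
Qed.

Section EvalForms.
Variables (K M N : fieldType) (i1 : {rmorphism K -> M}) (i2 : {rmorphism K -> N}).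
Variable h : {rmorphism M -> N}.
Hypothesis hi : forall a, h (i1 a) = i2 a.

Lemma meval_map_mx n (f : {mpoly K[n]}) (v : 'rV[M]_n) :
  (map_mpoly i2 f).@[(map_mx h v) 0] = h (map_mpoly i1 f).@[v 0].
Proof.
rewrite !meval_map_mpoly rmorph_sum; apply: eq_bigr => m _.
rewrite rmorphM /= hi rmorph_prod; congr (_ * _).
by apply: eq_bigr => i _; rewrite mxE rmorphXn.
Qed.

Lemma eval_forms_map m n (f : 'I_m -> {mpoly K[n]}) (v : 'rV[M]_n) :
  eval_forms i2 f (map_mx h v) = map_mx h (eval_forms i1 f v).
Proof. by apply/rowP=> i; rewrite !mxE meval_map_mx. Qed.

End EvalForms.

Section GaloisAction.
Variables (K : fieldExtType rat) (iota : {rmorphism K -> algC}).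
Variable A : abelian_variety iota.
Variables (L : splittingFieldType K) (j : {rmorphism L -> algC}).
Hypothesis hj : forall a : K, j (a%:A) = iota a.

Notation pt := (@av_embed K iota A).
Notation S := (@av_rational K iota A L j).
Implicit Types (s t : gal_of {:L}) (x y : av_pts A) (v : 'rV[L]_(av_ambient A).+1).

(** Coordinates with entries in L, so that an automorphism of L acts on them without being extended
    to [algC]. *)
Definition has_coords x v : Prop := hcoords (pt x) (map_mx j v).

Lemma map_mx_coords_neq0 (h : {rmorphism L -> L}) x v :
  has_coords x v -> map_mx j (map_mx h v) != 0.
Proof. by case/andP; rewrite !map_mx_eq0. Qed.

(** The scalar, a priori in [algC], is a quotient of two coordinates and so lies in L. *)
Lemma has_coords_scale x v v' : has_coords x v -> has_coords x v' ->
  exists2 c, c != 0 & v' = c *: v.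
Proof.
move=> xv xv'; have [l l0 e] := hcoords_scale xv xv'.
have /andP[] := xv; rewrite map_mx_eq0 => v0 _.
have [i vi] : exists i, v 0 i != 0 by apply/rV0Pn.
have jv i' : j (v' 0 i') = l * j (v 0 i') by move/rowP/(_ i'): e; rewrite !mxE.
have ec : j (v' 0 i / v 0 i) = l by rewrite fmorph_div jv mulfK // fmorph_eq0.
exists (v' 0 i / v 0 i); first by rewrite -(fmorph_eq0 j) ec.
by apply/rowP=> i'; apply: (fmorph_inj j); rewrite jv mxE rmorphM ec.
Qed.

Lemma has_coords_inj x y v : has_coords x v -> has_coords y v -> x = y.
Proof. by move=> xv yv; apply: (@av_embed_inj _ _ A); apply: hcoords_inj xv yv. Qed.

Lemma eval_forms_j m n (f : 'I_m -> {mpoly K[n]}) (w : 'rV[L]_n) :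
  eval_forms iota f (map_mx j w) = map_mx j (eval_forms (in_alg L) f w).
Proof. by apply: eval_forms_map => a; apply: hj. Qed.

Lemma eval_forms_gal s m n (f : 'I_m -> {mpoly K[n]}) (w : 'rV[L]_n) :
  eval_forms (in_alg L) f (map_mx s w) = map_mx s (eval_forms (in_alg L) f w).
Proof. by apply: eval_forms_map => a /=; rewrite linearZ /= rmorph1. Qed.

(** The equations of A have coefficients in K, which automorphisms of L over K fix. *)
Lemma conj_point s x v : has_coords x v -> exists y, has_coords y (map_mx s v).
Proof.
move=> xv; have [P Pv] := hcoords_exists (map_mx_coords_neq0 s xv).
have [y ey] : exists y, pt y = P.
  apply/(@av_embed_image _ _ A) => f fA w Pw.
  have [d fd] := av_eqs_homog fA.
  have [c _ ->] := hcoords_scale Pv Pw.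
  rewrite (homog_scale _ _ (map_mpoly_homog iota fd)).
  have e1 : (map_mpoly iota f).@[(map_mx j (map_mx s v)) 0]
      = j (s (map_mpoly (in_alg L) f).@[v 0]).
    rewrite (@meval_map_mx _ _ _ (in_alg L)) ?hj //; congr (j _).
    by apply: meval_map_mx => a /=; rewrite linearZ /= rmorph1.
  have e2 : j (map_mpoly (in_alg L) f).@[v 0] = 0.
    rewrite -(@meval_map_mx _ _ _ _ iota j) ?hj //.
    have := (@av_embed_image _ _ A (pt x)).1 (ex_intro _ x erefl) f fA; exact.
  move/eqP: e2; rewrite fmorph_eq0 => /eqP e2.
  by rewrite e1 e2 !rmorph0 mulr0.
by exists y; rewrite /has_coords ey.
Qed.

(** The forms giving the inverse near x have coefficients in K, so they commute with conjugation.
    They do not vanish at a conjugate of x either, and the same formula holds there. *)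
Lemma has_coords_opp x v : has_coords x v -> exists w,
  has_coords (- x) w /\
  forall s y, has_coords y (map_mx s v) -> has_coords (- y) (map_mx s w).
Proof.
move=> xv; have [d [f [_ fne fE]]] := @av_opp_morphism _ _ A x.
exists (eval_forms (in_alg L) f v).
have ne := fne _ xv; split; first by rewrite /has_coords -eval_forms_j; apply: fE.
move=> s y yv; rewrite /has_coords -eval_forms_gal -eval_forms_j; apply: fE => //.
rewrite eval_forms_j eval_forms_gal !map_mx_eq0.
by move: ne; rewrite eval_forms_j map_mx_eq0.
Qed.

Lemma has_coords_add x1 x2 v1 v2 : has_coords x1 v1 -> has_coords x2 v2 ->
  exists w, has_coords (x1 + x2) w /\
  forall s y1 y2, has_coords y1 (map_mx s v1) -> has_coords y2 (map_mx s v2) ->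
    has_coords (y1 + y2) (map_mx s w).
Proof.
move=> xv1 xv2; have [d [e [f [_ fne fE]]]] := @av_add_morphism _ _ A x1 x2.
exists (eval_forms (in_alg L) f (row_mx v1 v2)).
have ne := fne _ _ xv1 xv2; split.
  by rewrite /has_coords -eval_forms_j map_row_mx; apply: fE.
move=> s y1 y2 yv1 yv2; rewrite /has_coords -eval_forms_gal -eval_forms_j !map_row_mx.
apply: fE => //; rewrite -!map_row_mx eval_forms_j eval_forms_gal !map_mx_eq0.
by move: ne; rewrite -map_row_mx eval_forms_j map_mx_eq0.
Qed.

Lemma rational_sub x y : S x -> S y -> S (x - y).
Proof.
move=> [v xv] [w yw]; have [w' [yw' _]] := has_coords_opp yw.
by have [u [xyu _]] := has_coords_add xv yw'; exists u.
Qed.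

Lemma base_rational_coords x : av_rational iota x ->
  exists v : 'rV[K]_(av_ambient A).+1, has_coords x (map_mx (in_alg L) v).
Proof.
case=> v xv; exists v; rewrite /has_coords.
suff -> : map_mx j (map_mx (in_alg L) v) = map_mx iota v by [].
by apply/rowP=> i; rewrite !mxE; apply: hj.
Qed.

Lemma rational0 : S 0.
Proof. by have [v xv] := base_rational_coords (@av_zero_rational _ _ A); exists (map_mx (in_alg L) v). Qed.

Lemma gal_act_exists : exists act : gal_of {:L} -> av_pts A -> av_pts A,
  forall s x v, has_coords x v -> has_coords (act s x) (map_mx s v).
Proof.
have /choice[f fP] : forall sx : gal_of {:L} * av_pts A, exists y,
    forall v, has_coords sx.2 v -> has_coords y (map_mx sx.1 v).
  case=> s x /=; have [[v xv]|none] := pselect (exists v, has_coords x v); last first.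
    (* Outside A(L) the action takes the arbitrary value 0. *)
    by exists 0 => v xv; case: none; exists v.
  have [y yv] := conj_point s xv; exists y => v' xv'.
  have [c c0 ->] := has_coords_scale xv xv'.
  have -> : map_mx s (c *: v) = s c *: map_mx s v.
    by apply/rowP=> i; rewrite !mxE rmorphM.
  rewrite /has_coords map_mxZ; apply: hcoordsZ => //.
  by rewrite !fmorph_eq0.
by exists (fun s x => f (s, x)) => s x v; apply: (fP (s, x)).
Qed.

(** Scaling one coordinate to 1 removes the projective ambiguity: the scalar relating the vector to
    its conjugate must then be 1, so each coordinate is Galois-fixed and lies in K. *)
Lemma gal_fixed_rational x : galois 1 {:L} -> S x ->
    (forall s v, s \in 'Gal({:L} / 1)%g -> has_coords x v -> has_coords x (map_mx s v)) ->
  av_rational iota x.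
Proof.
move=> /galois_fixedField gal [v xv] fx.
have /andP[] := xv; rewrite map_mx_eq0 => v0 _.
have [i vi] : exists i, v 0 i != 0 by apply/rV0Pn.
pose w := (v 0 i)^-1 *: v.
have wi : w 0 i = 1 by rewrite mxE mulVf.
have xw : has_coords x w.
  by rewrite /has_coords map_mxZ hcoordsZ // fmorph_eq0 invr_eq0.
have wfix s : s \in 'Gal({:L} / 1)%g -> map_mx s w = w.
  move=> sG; have [c _ e] := has_coords_scale xw (fx s w sG xw).
  have : (map_mx s w) 0 i = (c *: w) 0 i by rewrite e.
  by rewrite [LHS]mxE [RHS]mxE wi rmorph1 mulr1 e => <-; rewrite scale1r.
have w1 i' : exists k : K, w 0 i' = k%:A.
  suff : w 0 i' \in fixedField 'Gal({:L} / 1)%g by rewrite gal => /vlineP.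
  apply/fixedFieldP; first exact: memvf.
  by move=> s sG; move/rowP/(_ i'): (wfix s sG); rewrite mxE.
have [k kP] := choice w1.
exists (\row_i' k i'); suff -> : map_mx iota (\row_i' k i') = map_mx j w by [].
by apply/rowP=> i'; rewrite !mxE -hj -kP mxE.
Qed.

End GaloisAction.

(** * Ranks with values in the extended naturals *)

Lemma subgroup_rankE (V : zmodType) (S : V -> Prop) r :
  is_rank S r -> subgroup_rank S = Some r.
Proof.
move=> Sr; rewrite /subgroup_rank; case: pselect => [rP|[]]; last by exists r.
case: (cid rP) => s Ss /=; congr Some; apply/eqP; rewrite eqn_leq.
by case: Sr => Sr /(_ _ Ss.1) ->; case: Ss => _ ->.
Qed.

Lemma is_rank_sub (V : zmodType) (S S' : V -> Prop) s :
  (forall x, S' x -> S x) -> is_rank S s -> exists r, is_rank S' r.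
Proof.
move=> sub [_ smax].
have ex : exists r, `[< has_indep_family S' r >].
  exists 0%N; apply/asboolP; exists (fun=> 0); split; first by case.
  by move=> c _ [].
have bound r : `[< has_indep_family S' r >] -> (r <= s)%N.
  by move=> /asboolP /(has_indep_family_sub sub); apply: smax.
case: (ex_maxnP ex bound) => r /asboolP Sr rmax.
by exists r; split=> // k Sk; apply/rmax/asboolP.
Qed.

Lemma is_rank_ext (V : zmodType) (S S' : V -> Prop) r :
  (forall x, S x <-> S' x) -> is_rank S r -> is_rank S' r.
Proof.
move=> SS' [Sr rmax]; split; first by apply: has_indep_family_sub Sr => x /SS'.
by move=> k Sk; apply: rmax; apply: has_indep_family_sub Sk => x /SS'.
Qed.

Lemma alt_on_setT (T : finType) (g : {perm T}) : alt_on setT g = (g \in 'Alt_T)%g.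
Proof.
have gT : perm_on setT g by apply/subsetP=> x _; rewrite inE.
by rewrite Alt_even /alt_on gT.
Qed.

Theorem theorem2p3 (K : fieldExtType rat) (iota : {rmorphism K -> algC})
    (A : abelian_variety iota) (n : nat) (hn : (3 <= n)%N)
    (L : splittingFieldType K) (j : {rmorphism L -> algC})
    (hj : forall a : K, j (a%:A)%R = iota a)
    (hgal : galois 1 {: L})
    (hG : ('Gal({: L} / 1) \isog 'Alt_('I_n))%g) :
  mw_rank A j = mw_rank A iota \/
  ((n = 4 -> enat_le (enat_add (mw_rank A iota) 2) (mw_rank A j)) /\
   ((n = 3 \/ (5 <= n)%N) ->
    enat_le (enat_add (mw_rank A iota) (n - 1)%N) (mw_rank A j))).
Proof.
(* If A(L) has no finite rank, its rank is the top element and the inequalities hold. *)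
have [[s Ss]|inf] := pselect (exists s, is_rank (av_rational (A := A) j) s); last first.
  have -> : mw_rank A j = None by rewrite /mw_rank /subgroup_rank; case: pselect.
  by right; split=> _; case: (enat_add _ _).
have Ksub x : av_rational iota x -> av_rational (A := A) j x.
  by move=> /(base_rational_coords hj)[v xv]; exists (map_mx (in_alg L) v).
have [r Kr] := is_rank_sub Ksub Ss.
rewrite /mw_rank (subgroup_rankE Ss) (subgroup_rankE Kr).
have [act actP] := gal_act_exists A hj.
have act_eq (t : gal_of {:L}) x y v : has_coords j x v -> has_coords j y (map_mx t v) -> act t x = y.
  by move=> xv yv; apply: has_coords_inj (actP t x v xv) yv.
move: hG; rewrite isog_sym => /isogP[f _ fG].
have fM (g h : {perm 'I_n}) : alt_on setT g -> alt_on setT h -> f (g * h)%g = (f g * f h)%g.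
  by rewrite !alt_on_setT => gA hA; rewrite morphM.
pose S := av_rational (A := A) j.
have gap : s = r \/ (r + 2 <= s)%N /\ ((5 <= #|[set: 'I_n]|)%N -> (r + #|[set: 'I_n]|.-1 <= s)%N).
  apply: (@fixed_rank_gap _ setT _ S (fun g x => act (f g) x)) => //.
  - exact: rational0 hj.
  - exact: rational_sub hj.
  - by move=> g x _ [v xv]; exists (map_mx (f g) v); apply: actP.
  - move=> g x y _ [v xv] [w yw].
    have [w' [yw' oppP]] := has_coords_opp hj yw.
    have [u [xyu addP]] := has_coords_add hj xv yw'.
    by apply: act_eq xyu _; apply: addP; [apply: actP | apply/oppP/actP].
  - move=> x [v xv]; apply: (act_eq _ _ _ _ xv); rewrite morph1.
    suff -> : map_mx (1%g : gal_of {:L}) v = v by [].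
    by apply/rowP=> i; rewrite mxE gal_id.
  - move=> g h x gA hA [v xv]; rewrite fM //; apply: (act_eq _ _ _ _ xv).
    suff -> : map_mx (f g * f h)%g v = map_mx (f h) (map_mx (f g) v).
      by apply/actP/actP.
    by apply/rowP=> i; rewrite !mxE galM ?memvf.
  - apply: is_rank_ext Kr => x; split=> [Kx|[Sx fx]].
      have [v xv] := base_rational_coords hj Kx.
      split=> [|g gA]; first exact: Ksub.
      apply: (act_eq _ _ _ _ xv); suff -> : map_mx (f g) (map_mx (in_alg L) v) = map_mx (in_alg L) v by [].
      by apply/rowP=> i; rewrite !mxE /= linearZ /= rmorph1.
    apply: (gal_fixed_rational hj) => // t v tG xv.
    have /morphimP[g gA _ et] : t \in (f @* 'Alt_('I_n))%g by rewrite fG.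
    by rewrite -{1}(fx g) ?alt_on_setT // et; apply: actP.
rewrite cardsT card_ord in gap.
(* The gap 2 serves n = 4 as well as n = 3, where it equals n - 1. *)
case: gap => [->|[gap2 gap5]]; [by left | right; split=> [_ //|[n3|n5]] /=].
  by rewrite n3.
by rewrite subn1 gap5.
Qed.
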